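(* For each $n\ge 1$, let $\boldsymbol{G}_n$ be a uniform random unlabeled permutation graph with $n$ vertices (all $\boldsymbol{G}_n$ being defined on a common probability space). Then, in the space of graphons, $\boldsymbol{G}_n \to W^{(\mathrm{perm})}$ almost surely as $n\to+\infty$, i.e. $\delta_{\Box}(W_{\boldsymbol{G}_n},W^{(\mathrm{perm})})\to 0$ almost surely.
   Context: Permutation graphs. For a permutation $\sigma$ of $\{1,\dots,n\}$, the inversion graph $G_\sigma$ is the unlabeled version of the graph on vertex set $\{1,\dots,n\}$ in which $i\neq j$ are adjacent if and only if $(\sigma(i)-\sigma(j))(i-j)<0$. A permutation graph is an unlabeled graph (graph up to isomorphism) equal to $G_\sigma$ for some permutation $\sigma$. Uniform means uniform over the finite set of unlabeled permutation graphs with $n$ vertices. Graphons. A function $\phi$ on $[0,1]$ is Lebesgue-preserving if it is measurable and pushes Lebesgue measure to Lebesgue measure. A graphon is represented by a symmetric measurable function $w:[0,1]^2\to[0,1]$. The cut metric is $\delta_{\Box}(u,w)=\inf_{\phi}\sup_{S,T\subseteq[0,1]}\left|\int_{S\times T}\big(u(x,y)-w(\phi(x),\phi(y))\big)\,dx\,dy\right|$, where $\phi$ ranges over invertible Lebesgue-preserving maps $[0,1]\to[0,1]$ and $S,T$ over measurable sets. The space of graphons is the set of such functions, with functions at $\delta_\Box$-distance $0$ identified, with the metric $\delta_\Box$. To a graph $G$ with $n$ vertices labeled $1,\dots,n$ and adjacency matrix $A$ one associates the graphon $W_G$ represented by $w_G(x,y)=A_{\lceil nx\rceil,\lceil ny\rceil}$;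 it does not depend on the labeling. A sequence of graphs $H_n$ converges to $W$ if $\delta_\Box(W_{H_n},W)\to0$. The limit. Let $\Psi=(\Psi_1,\Psi_2):[0,1]\to[0,1]^2$ be any measurable function pushing Lebesgue measure on $[0,1]$ to Lebesgue measure on $[0,1]^2$. $W^{(\mathrm{perm})}$ is the graphon represented by $(x,y)\mapsto \mathbb 1[(\Psi_1(x)-\Psi_1(y))(\Psi_2(x)-\Psi_2(y))<0]$; as an element of the space of graphons it does not depend on the choice of $\Psi$. *)

(* Defs.v *)
From HB Require Import structures.
From mathcomp Require Import all_boot all_order all_algebra all_fingroup.
From mathcomp Require Import generic_quotient.
From mathcomp Require Import all_classical all_reals all_analysis.
From mathcomp Require Import measurable_realfun.

Set Implicit Arguments.
Unset Strict Implicit.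
Unset Printing Implicit Defensive.

Import Order.TTheory GRing.Theory Num.Theory.
Import numFieldNormedType.Exports.

Local Open Scope ring_scope.

Definition is_adj n (A : 'M[bool]_n) : bool :=
  [forall i, ~~ A i i] && [forall i, forall j, A i j == A j i].

Record lgraph n := LGraph { adj :> 'M[bool]_n; adjP : is_adj adj }.

HB.instance Definition _ n := [isSub for @adj n].
HB.instance Definition _ n := [Finite of lgraph n by <:].

Definition lgraph_iso n (g h : lgraph n) : bool :=
  [exists s : 'S_n, forall i, forall j, g i j == h (s i) (s j)].

Lemma lgraph_isoP n (g h : lgraph n) :
  reflect (exists s : 'S_n, forall i j, g i j = h (s i) (s j))
          (lgraph_iso g h).
Proof.
apply: (iffP existsP) => -[s H]; exists s.
  by move=> i j; move/forallP: H => /(_ i) /forallP /(_ j) /eqP.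
by apply/forallP => i; apply/forallP => j; rewrite H.
Qed.

Lemma lgraph_iso_refl n : reflexive (@lgraph_iso n).
Proof. by move=> g; apply/lgraph_isoP; exists 1%g => i j; rewrite !perm1. Qed.

Lemma lgraph_iso_sym n : symmetric (@lgraph_iso n).
Proof.
suff H g h : @lgraph_iso n g h -> lgraph_iso h g.
  by move=> g h; apply/idP/idP; apply: H.
move=> /lgraph_isoP[s sP]; apply/lgraph_isoP; exists s^-1%g => i j.
by rewrite sP !permKV.
Qed.

Lemma lgraph_iso_trans n : transitive (@lgraph_iso n).
Proof.
move=> h g k /lgraph_isoP[s sP] /lgraph_isoP[t tP]; apply/lgraph_isoP.
by exists (s * t)%g => i j; rewrite sP tP !permM.
Qed.

Canonical lgraph_equiv n :=
  EquivRel (@lgraph_iso n) (@lgraph_iso_refl n) (@lgraph_iso_sym n)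
    (@lgraph_iso_trans n).

Definition ugraph n := {eq_quot (@lgraph_iso n)}%qT.

HB.instance Definition _ n := EqQuotient.on (ugraph n).
HB.instance Definition _ n := Choice.on (ugraph n).
HB.instance Definition _ n :=
  Countable.copy (ugraph n) (can_type (@reprK _ (ugraph n))).
HB.instance Definition _ n :=
  fintype.isFinite.Build (ugraph n)
    (pcan_enumP (can_pcan (@reprK _ (ugraph n)))).

Definition inv_mx n (s : 'S_n) : 'M[bool]_n :=
  \matrix_(i, j) (((s i)%:Z - (s j)%:Z) * (i%:Z - j%:Z) < 0).

Lemma inv_mx_is_adj n (s : 'S_n) : is_adj (inv_mx s).
Proof.
apply/andP; split; apply/forallP => i; first by rewrite mxE !subrr mul0r ltxx.
by apply/forallP => j; rewrite !mxE -(opprB (s i)%:Z) -(opprB i%:Z) mulrNN.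
Qed.

Definition inversion_graph n (s : 'S_n) : ugraph n :=
  (\pi_(ugraph n) (LGraph (inv_mx_is_adj s)))%qT.

Definition permutation_graphs n : {set ugraph n} :=
  [set inversion_graph s | s : 'S_n]%SET.

Local Open Scope classical_set_scope.
Local Open Scope ereal_scope.

(* [X] is a random element of the finite type [F] (with its discrete
   sigma-algebra) whose law is uniform on [A]. *)
Definition uniform_on (R : realType) d (T : measurableType d)
    (P : probability T R) (F : finType) (A : {set F}) (X : T -> F) : Prop :=
  forall x : F, measurable (X @^-1` [set x]) /\
    P (X @^-1` [set x]) = (if x \in A then (#|A|%:R^-1)%R else 0%R)%:E.

Definition pushes_to d1 d2 (T1 : measurableType d1) (T2 : measurableType d2)
    (R : realType) (D : set T1) (mu : set T1 -> \bar R)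
    (E : set T2) (nu : set T2 -> \bar R) (f : T1 -> T2) : Prop :=
  [/\ {homo f : x / D x >-> E x}, measurable_fun D f &
      forall A, measurable A -> A `<=` E -> mu (D `&` f @^-1` A) = nu A].

Section Graphons.
Variable R : realType.

Local Notation I := (`[0%R, 1%R] : set R).
Local Notation leb := (@lebesgue_measure R).
Local Notation leb2 := (leb \x leb).

Definition lebesgue_preserving (phi : R -> R) : Prop :=
  pushes_to I leb I leb phi.

Definition pushes_to_square (Psi : R -> R * R) : Prop :=
  pushes_to I leb (I `*` I) leb2 Psi.

(* Invertible within Lebesgue-preserving maps; for Borel bijections of [0, 1]
   the inverse is automatically Borel (Lusin-Souslin). *)
Definition invertible_lebesgue_preserving (phi : R -> R) : Prop :=
  lebesgue_preserving phi /\
  exists2 psi : R -> R, lebesgue_preserving psi &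
    {in I, cancel phi psi} /\ {in I, cancel psi phi}.

(* Only the values on [0, 1]^2 are relevant. *)
Record graphon := Graphon {
  gfun :> R -> R -> R;
  gfun_sym : forall x y, I x -> I y -> gfun x y = gfun y x;
  gfun_range : forall x y, I x -> I y -> (0 <= gfun x y <= 1)%R;
  gfun_measurable : measurable_fun (I `*` I) (fun z => gfun z.1 z.2) }.

Definition cut_norm (f : R * R -> R) : \bar R :=
  ereal_sup [set r | exists S T : set R,
    [/\ measurable S, measurable T, S `<=` I, T `<=` I &
        r = `| \int[leb2]_(z in S `*` T) (f z)%:E |]].

Definition cut_dist (u w : graphon) : \bar R :=
  ereal_inf [set r | exists2 phi, invertible_lebesgue_preserving phi &
    r = cut_norm (fun z => u z.1 z.2 - w (phi z.1) (phi z.2))%R].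

(* A_(ceil(n x), ceil(n y)), the rows and columns of A being numbered from 1.
   On the null set where x = 0 or y = 0 the value is 0. *)
Definition step_fun n (g : lgraph n) (x y : R) : R :=
  [exists i : 'I_n, exists j : 'I_n,
     [&& Num.ceil (n%:R * x)%R == i.+1%:Z,
         Num.ceil (n%:R * y)%R == j.+1%:Z & g i j]]%:R.

Lemma step_fun_sym n (g : lgraph n) x y : step_fun g x y = step_fun g y x.
Proof.
rewrite /step_fun; congr ((nat_of_bool _)%:R)%R.
have gS i j : g i j = g j i.
  by case/andP: (adjP g) => _ /forallP /(_ i) /forallP /(_ j) /eqP.
apply/idP/idP => /existsP[i /existsP[j /and3P[a b c]]]; apply/existsP; exists j;
  by apply/existsP; exists i; rewrite a b gS c.
Qed.

Lemma bool_range (b : bool) : (0 <= (b%:R : R) <= 1)%R.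
Proof. by case: b; rewrite ?lexx ler01. Qed.

Lemma measurable_bool_natr (D : set (R * R)) (b : R * R -> bool) :
  measurable_fun D b -> measurable_fun D (fun z => (b z)%:R%R : R).
Proof.
move=> mb; rewrite (_ : (fun z => _) = (fun c : bool => c%:R%R : R) \o b) //.
by apply: measurableT_comp.
Qed.

Lemma step_fun_measurable n (g : lgraph n) :
  measurable_fun (I `*` I) (fun z => step_fun g z.1 z.2).
Proof.
apply: measurable_bool_natr.
apply: measurable_funTS.
apply: (measurable_fun_bool true).
rewrite setTI.
have mc k : measurable [set x : R | Num.ceil (n%:R * x)%R = k].
  rewrite (_ : mkset _ =
      (fun x : R => n%:R * x)%R @^-1` `](k - 1)%:~R, k%:~R]).
    rewrite -[X in measurable X]setTI.
    by apply: mulrl_measurable => //; exact: measurable_itv.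
  by apply/seteqP; split => x /=; rewrite in_itv /= -ceil_eq; move/eqP.
rewrite (_ : _ @^-1` _ =
    \bigcup_(i in [set: 'I_n]) \bigcup_(j in [set j : 'I_n | g i j])
      ([set x : R | Num.ceil (n%:R * x)%R = i.+1%:Z] `*`
       [set x : R | Num.ceil (n%:R * x)%R = j.+1%:Z])).
  apply: fin_bigcup_measurable => [|i _]; first exact: finite_finset.
  apply: fin_bigcup_measurable => [|j _]; first exact: finite_finset.
  exact: measurableX.
apply/seteqP; split => -[x y] /=.
  by move=> /existsP[i /existsP[j /and3P[/eqP xi /eqP yj gij]]]; exists i => //;
    exists j.
move=> [i _ [j /= gij [/= xi yj]]]; apply/existsP; exists i.
by apply/existsP; exists j; rewrite xi yj gij !eqxx.
Qed.

Definition graph_graphon n (G : ugraph n) : graphon :=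
  let g := (repr G : lgraph n)%qT in
  @Graphon (step_fun g) (fun x y _ _ => step_fun_sym g x y)
    (fun x y _ _ => bool_range _) (step_fun_measurable g).

Definition perm_fun (Psi : R -> R * R) (x y : R) : R :=
  ((((Psi x).1 - (Psi y).1) * ((Psi x).2 - (Psi y).2) < 0)%R : bool)%:R%R.

Lemma perm_fun_sym Psi x y : perm_fun Psi x y = perm_fun Psi y x.
Proof.
by rewrite /perm_fun -(opprB (Psi x).1) -(opprB (Psi x).2) mulrNN.
Qed.

Lemma perm_fun_measurable Psi : pushes_to_square Psi ->
  measurable_fun (I `*` I) (fun z => perm_fun Psi z.1 z.2).
Proof.
move=> [_ mPsi _]; apply: measurable_bool_natr.
have mI : measurable I by exact: measurable_itv.
have m1 : measurable_fun (I `*` I) (fun z : R * R => Psi z.1).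
  by apply: (measurable_comp mI) => //= [_ [z [? _] <-]|] //; exact: measurable_funTS.
have m2 : measurable_fun (I `*` I) (fun z : R * R => Psi z.2).
  by apply: (measurable_comp mI) => //= [_ [z [_ ?] <-]|] //; exact: measurable_funTS.
apply: measurable_fun_ltr => //.
by apply: measurable_funM; apply: measurable_funB; apply: measurableT_comp.
Qed.

Definition perm_graphon (Psi : R -> R * R) (hPsi : pushes_to_square Psi) :=
  @Graphon (perm_fun Psi) (fun x y _ _ => perm_fun_sym Psi x y)
    (fun x y _ _ => bool_range _) (perm_fun_measurable hPsi).

End Graphons.

(* Main.v *)
Require Import Defs.
From mathcomp Require Import all_boot all_order all_algebra all_fingroup.
From mathcomp Require Import generic_quotient zify ring lra.
From mathcomp Require Import all_classical all_reals all_analysis.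
From mathcomp Require Import measurable_realfun.
Import Order.TTheory GRing.Theory Num.Theory.
Import numFieldNormedType.Exports.

(** Two facts carry the theorem: a uniform random permutation is close to the
    uniform permuton with overwhelming probability, and passing from
    permutations to unlabeled permutation graphs loses only a subexponential
    factor.

    For the second fact, a permutation [s] of size [n] is determined by its
    unlabeled inversion graph together with the position, the value and the
    vertex of a few pinned points: the first [k] positions, and both ends of
    every later step whose two values are not separated by one of the first [k]
    values (lemma [inv_mx_pinned_inj]).  Indeed the adjacencies to the first [k]
    points tell in which horizontal strip each point lies; for two points in
    different strips adjacency then tells which one is further left, so all
    steps, hence all positions, are recovered.  On average there are about
    [2 * n / k] unseparated steps, so for [k] close to the square root of [n] at
    least half of the permutations have only [O(sqrt n)] pinned points, and the
    number of permutation graphs is at least [n! / (2 * n ^ O(sqrt n))] (lemma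
    [fact_le_permutation_graphs]).

    For the first fact, cut the square into [m ^ 2] equal cells.  A factorial
    moment bound (lemma [card_hits_tail]) shows that all but an exponentially
    small proportion of the permutations are balanced: no cell contains more
    than [(1 / m ^ 2 + 1 / m ^ 3) * n] points.  Upper bounds are enough, since
    the cell counts add up to [n].  An exponentially small proportion stays
    exponentially small after multiplication by [n ^ O(sqrt n)], so the
    proportion of permutation graphs with no balanced representative is
    summable (lemma [unbalanced_ratio]) and Borel-Cantelli applies.

    It remains to see that a balanced permutation gives a graph at distance at
    most [6 / m] from the limit (lemma [cut_dist_balanced]).  Colour the points
    of the unit interval by the cell that contains their image under [Psi].  By
    regularity of the Lebesgue measure this colouring is constant on short
    intervals up to a small error (lemma [coloured_blocks]).  The vertices of
    the graph are also coloured by cells, and each of the [m ^ 2] colours has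
    nearly the same weight on both sides, so some permutation of many short
    intervals of equal length matches the two colourings up to a small error
    (lemma [colour_matching]).  It induces an invertible measure-preserving map
    [phi].  Two points whose colours are matched and lie in different rows and
    different columns see the same value in both graphons, so the two functions
    agree outside a set of small measure (lemma [cut_dist_colouring]). *)

Set Implicit Arguments.
Unset Strict Implicit.
Unset Printing Implicit Defensive.

(** * Recovering a permutation from its inversion graph *)

(** An increasing [t] satisfies [i <= t i], and both sides have the same sum
    over all [i]. *)
Lemma perm_incr_id n (t : 'S_n) :
  (forall i j : 'I_n, j = i.+1 :> nat -> t i < t j) -> t = 1%g.
Proof.
move=> ht.
have le_t m (i : 'I_n) : i = m :> nat -> i <= t i.
  elim: m i => [|m IH] i im; first by rewrite im.
  have lt_mn : m < n by rewrite -im in IH *; have := ltn_ord i; lia.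
  have := IH (Ordinal lt_mn) erefl; have := ht (Ordinal lt_mn) i im.
  by rewrite /=; lia.
have /leqif_sum /= [_] : forall i : 'I_n, true -> i <= t i ?= iff (i == t i :> nat).
  by move=> i _; split => //; exact: le_t.
rewrite (reindex_inj (@perm_inj _ t)) /= eqxx => /esym/forallP fix_t.
by apply/permP => i; rewrite perm1; apply/val_inj/esym/eqP/fix_t.
Qed.

(** Relative to the first [k] positions, whose values are to be known: such a
    value lying between [s i] and [s j] reveals how [s i] compares with
    [s j]. *)
Definition separated n k (s : 'S_n) (i j : 'I_n) : bool :=
  [exists l : 'I_n, (l < k) && ((s i < s l < s j) || (s j < s l < s i))].

Definition unseparated_steps n k (s : 'S_n) : {set 'I_n} :=
  [set i : 'I_n | [&& k <= i, i.+1 < n & ~~ separated k s i (ordS i)]].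

Lemma card_ltn_ord n k : k <= n -> #|[set l : 'I_n | l < k]| = k.
Proof.
move=> kn; rewrite -sum1_card (eq_bigl (fun l : 'I_n => l < k)); last first.
  by move=> i; rewrite inE.
by rewrite -(big_ord_widen _ (fun _ => 1)) // sum1_card card_ord.
Qed.

(** Exchangeability: the count does not change when [i] is replaced by any of
    the [k.+1] positions in [T], the first [k] ones and [i] itself.  For a fixed
    permutation, at most two positions of [T] have a value next to [s j] among
    the values on [T]: the one just below and the one just above. *)
Lemma card_unseparated_pair n k (i j : 'I_n) : k <= i -> k <= j -> i != j ->
  #|[set s : 'S_n | ~~ separated k s i j]| * k.+1 <= 2 * n`!.
Proof.
move=> ki kj neq_ij.
pose T : {set 'I_n} := (i |: [set l : 'I_n | l < k])%SET.
have cT : #|T| = k.+1.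
  rewrite cardsU1 inE -leqNgt ki card_ltn_ord //.
  exact: leq_trans ki (ltnW (ltn_ord i)).
have jT : j \notin T by rewrite !inE negb_or eq_sym neq_ij -leqNgt.
rewrite mulnC -cT -sum_nat_const.
(* The exchange of [i] with [a] amounts to the change of variable
   [s := tperm a i * s]. *)
have swap_count a : #|[set s : 'S_n | ~~ separated k s i j]| =
    \sum_(s : 'S_n) (~~ separated k (tperm a i * s)%g i j : nat).
  rewrite -sum1dep_card big_mkcond (reindex_inj (mulgI (tperm a i))) /=.
  by apply: eq_bigr => s _; case: separated.
under eq_bigr => a _ do rewrite (swap_count a).
rewrite exchange_big /=.
have -> : 2 * n`! = \sum_(s : 'S_n) 2.
  by rewrite sum_nat_const mulnC card_Sn.
apply: leq_sum => s _; rewrite -big_mkcondr sum1dep_card.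
pose A := [set a : 'I_n | (a \in T) && ~~ separated k (tperm a i * s)%g i j]%SET.
have noA a b : a \in A -> b \in A -> (s a < s b < s j) || (s j < s b < s a) -> False.
  rewrite !inE => /andP[aT /negP nsep] /andP[bT _] btw; apply: nsep.
  have ja : tperm a i j = j.
    by rewrite tpermD //; apply: contraNneq jT => <-; rewrite !inE.
  have neq_ba : b != a by apply: contraTneq btw => ->; rewrite ltnn andbF.
  apply/existsP; exists (tperm a i b).
  rewrite !permM tpermR ja tpermK btw andbT.
  case: (eqVneq b i) => [bi|bi].
    rewrite bi tpermR; case/orP: aT => // /eqP ai.
    by rewrite ai bi eqxx in neq_ba.
  rewrite tpermD 1?eq_sym // 1?eq_sym //.
  by move: bT; rewrite (negbTE bi).
rewrite (_ : [set x in T | _] = A)%SET //.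
rewrite -(cardsID [set a | s a < s j]%SET A) (_ : 2 = 1 + 1) //.
have neq_sj a : a \in A -> s a != s j.
  rewrite inE => /andP[aT _]; rewrite (inj_eq perm_inj).
  by apply: contraTneq aT => ->.
apply: leq_add; apply/card_le1_eqP => a b.
  move=> /setIP[aA]; rewrite inE => saj /setIP[bA]; rewrite inE => sbj.
  have [//|neq_ab] := eqVneq a b; have := noA _ _ aA bA; have := noA _ _ bA aA.
  have : s a != s b by rewrite (inj_eq perm_inj).
  by rewrite -val_eqE /= in saj sbj *; lia.
move=> /setDP[aA]; rewrite inE => saj /setDP[bA]; rewrite inE => sbj.
have [//|neq_ab] := eqVneq a b; have := noA _ _ aA bA; have := noA _ _ bA aA.
have : s a != s b by rewrite (inj_eq perm_inj).
have := neq_sj _ aA; have := neq_sj _ bA.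
by rewrite -!val_eqE /=; lia.
Qed.

(** By [card_unseparated_pair] the average number of unseparated steps is at
    most [2 * n / k.+1], which is at most half of [4 * k.+1]; hence Markov's
    inequality. *)
Lemma card_unseparated_steps n k : n <= k.+1 ^ 2 ->
  n`! <= 2 * #|[set s : 'S_n | #|unseparated_steps k s| < 4 * k.+1]|.
Proof.
move=> nk.
pose bad := [set s : 'S_n | 4 * k.+1 <= #|unseparated_steps k s|]%SET.
have sum_le : (\sum_(s : 'S_n) #|unseparated_steps k s|) * k.+1 <= n * (2 * n`!).
  under eq_bigr => s _ do rewrite -sum1dep_card big_mkcond /=.
  rewrite exchange_big /= big_distrl /=.
  apply: (@leq_trans (\sum_(i < n) 2 * n`!)); last first.
    by rewrite sum_nat_const card_ord.
  apply: leq_sum => i _.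
  have [/andP[ki in1]|/negbTE nki] := boolP ((k <= i) && (i.+1 < n)); last first.
    by rewrite big1 // => s _; rewrite andbA nki.
  have e1 : ordS i = i.+1 :> nat by rewrite /= modn_small.
  have ki1 : k <= ordS i by rewrite e1 leqW.
  have nei : i != ordS i by apply/eqP => /(congr1 (@nat_of_ord n)); rewrite e1; lia.
  apply: leq_trans (card_unseparated_pair ki ki1 nei).
  apply: leq_mul => //; rewrite -sum1dep_card [X in _ <= X]big_mkcond /=.
  by apply: leq_sum => s _; rewrite ki in1.
have bad_le : #|bad| * (4 * k.+1) <= \sum_(s : 'S_n) #|unseparated_steps k s|.
  rewrite -sum_nat_const [X in _ <= X](bigID (mem bad)) /=.
  by apply: leq_trans (leq_addr _ _); apply: leq_sum => s; rewrite inE.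
have half : 2 * #|bad| <= n`!.
  have : (2 * #|bad|) * (2 * n) <= n`! * (2 * n) by nia.
  case: (posnP n) => [n0|n_gt0]; last by rewrite leq_pmul2r // muln_gt0.
  move=> _; suff : #|bad| = 0 by move->.
  apply/eqP; rewrite cards_eq0 -finset.subset0; apply/fintype.subsetP => s.
  rewrite inE => le_s; have := leq_trans le_s (max_card _).
  by rewrite card_ord; lia.
have -> : [set s : 'S_n | #|unseparated_steps k s| < 4 * k.+1]%SET = (~: bad)%SET.
  by apply/setP => s; rewrite !inE ltnNge.
have := cardsC bad; rewrite card_Sn; lia.
Qed.

Lemma inv_mxE n (s : 'S_n) (i j : 'I_n) :
  inv_mx s i j = ((s i < s j) && (j < i)) || ((s j < s i) && (i < j)).
Proof.
rewrite mxE; case: (ltngtP (s i) (s j)) => sij; case: (ltngtP i j) => ij /=;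
  apply/idP/idP => //; nia.
Qed.

(** The inversions of [s] tell the relative order of all its values, so
    [s^-1 * s'] is increasing. *)
Lemma inv_mx_inj n : injective (@inv_mx n).
Proof.
move=> s s' eq_inv.
have same_order i j : (s i < s j) = (s' i < s' j).
  have := congr1 (fun A : 'M[bool]_n => A i j) eq_inv; rewrite !inv_mxE.
  have [->|neq_ij] := eqVneq i j; first by rewrite !ltnn.
  have : s i != s j by rewrite (inj_eq perm_inj).
  have : s' i != s' j by rewrite (inj_eq perm_inj).
  by rewrite -!val_eqE /= in neq_ij *; lia.
have /permP id_s : (s^-1 * s')%g = 1%g.
  apply: perm_incr_id => i j ij; rewrite !permM -same_order !permKV ij //.
by apply/permP => i; have := id_s (s i); rewrite permM permK perm1 => ->.
Qed.

(** The positions whose vertices have to be recorded next to the graph. *)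
Definition pinned n k (s : 'S_n) : {set 'I_n} :=
  ([set i : 'I_n | i < k] :|: unseparated_steps k s
    :|: [set ordS i | i in unseparated_steps k s])%SET.

(** Both permutations put [i] and [t i] in the same strip cut out by the common
    values at the first [k] positions, because [t] fixes these positions.  When
    two positions lie in different strips their values compare in the same way
    under [s] and [s'], so preserving inversions forces [t] to preserve their
    order.  This applies to every separated step, and the ends of the other
    steps are fixed by [t]; hence [t] is increasing. *)
Lemma inv_mx_pinned_inj n k (s s' t : 'S_n) :
  (forall i j, inv_mx s i j = inv_mx s' (t i) (t j)) ->
  {in pinned k s, forall i, t i = i} ->
  (forall i : 'I_n, i < k -> s i = s' i) -> s = s'.
Proof.
move=> iso fix_t eq_s.
have fix_lt (i : 'I_n) : i < k -> t i = i by move=> ik; apply: fix_t; rewrite !inE ik.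
have t_ge (i : 'I_n) : k <= i -> k <= t i.
  move=> ki; rewrite leqNgt; apply: contraL ki => tik.
  by rewrite -ltnNge -(perm_inj (fix_lt _ tik)).
have strip (l i : 'I_n) : l < k -> k <= i -> (s l < s i) = (s' l < s' (t i)).
  move=> lk ki; have := iso l i; rewrite !inv_mxE (fix_lt _ lk) (eq_s _ lk).
  have := t_ge i ki.
  have : s l != s i by rewrite (inj_eq perm_inj); apply: contraTneq lk => ->; rewrite -leqNgt.
  have : s' l != s' (t i).
    by rewrite (inj_eq perm_inj); apply: contraTneq lk => ->; rewrite -leqNgt t_ge.
  by rewrite -!val_eqE /= (eq_s _ lk); lia.
suff t1 : t = 1%g.
  by apply/inv_mx_inj/matrixP => i j; rewrite iso t1 !perm1.
apply: perm_incr_id => i j ji.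
have jS : j = ordS i by apply/val_inj; rewrite /= ji modn_small // -ji.
have [ik|ki] := ltnP i k.
  rewrite (fix_lt i ik); have [jk|kj] := ltnP j k.
    by rewrite (fix_lt _ jk) ji.
  exact: leq_trans ik (t_ge _ kj).
have kj : k <= j by rewrite ji ltnW.
have [unsep|sep] := boolP (i \in unseparated_steps k s).
  rewrite (fix_t i); last by move: unsep; rewrite !inE => ->; rewrite orbT.
  by rewrite (fix_t j) ?ji // !inE jS imset_f ?orbT.
move: sep; rewrite inE ki -ji ltn_ord -jS /= negbK.
case/existsP => l /andP[lk btw].
have := iso i j; have := strip l i lk ki; have := strip l j lk kj.
have : t i != t j by rewrite (inj_eq perm_inj) -val_eqE /= ji; lia.
by rewrite !inv_mxE -val_eqE /=; lia.
Qed.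

Lemma card_pinned n k (s : 'S_n) : #|unseparated_steps k s| < 4 * k.+1 ->
  #|pinned k s| <= 9 * k.+1.
Proof.
move=> U_lt; set U := unseparated_steps k s in U_lt.
have k_card : #|[set i : 'I_n | i < k]%SET| <= k.
  have [kn|nk] := leqP k n; first by rewrite card_ltn_ord.
  by apply: leq_trans (max_card _) _; rewrite card_ord ltnW.
apply: (@leq_trans (k + #|U| + #|U|)); last by lia.
apply: leq_trans (leq_card_setU _ _) _.
apply: leq_add; last exact: leq_imset_card.
by apply: leq_trans (leq_card_setU _ _) _; rewrite leq_add2r.
Qed.

Lemma inversion_graph_repr_iso n (s : 'S_n) : exists r : 'S_n, forall i j,
  inv_mx s i j = (repr (inversion_graph s) : lgraph n)%qT (r i) (r j).
Proof.
have /lgraph_isoP [r rP] : lgraph_iso (LGraph (inv_mx_is_adj s))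
    (repr (inversion_graph s))%qT.
  by apply/(@eqmodP _ (lgraph_equiv n)); rewrite reprK.
by exists r.
Qed.

(** Encode a permutation with few unseparated steps by its graph and, for each
    of at most [9 * k.+1] pinned positions, the position, its vertex in the
    representative of the graph, and its value.  The code is injective by
    [inv_mx_pinned_inj], and at least half of the permutations have one. *)
Lemma fact_le_permutation_graphs n k : 0 < n -> n <= k.+1 ^ 2 ->
  n`! <= 2 * (#|permutation_graphs n| * n ^ (27 * k.+1)).
Proof.
case: n => // n _ nk; apply: leq_trans (card_unseparated_steps nk) _.
rewrite leq_pmul2l //; set K := 9 * k.+1.
set good := [set s | _]%SET.
have [iso isoP] := choice (@inversion_graph_repr_iso n.+1).
pose list_pinned (s : 'S_n.+1) : {ffun 'I_K -> 'I_n.+1} :=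
  [ffun x : 'I_K => nth ord0 (enum (pinned k s)) x].
pose along (s r : 'S_n.+1) : {ffun 'I_K -> 'I_n.+1} :=
  [ffun x => r (list_pinned s x)].
have alongE s r x : along s r x = r (list_pinned s x) by rewrite ffunE.
pose code s := (inversion_graph s, (list_pinned s, along s (iso s), along s s)).
have code_inj : {in good &, injective code}.
  move=> s s' good_s _ [eqG eq_l /ffunP eq_iso /ffunP eq_val].
  (* The list has length [K], so it covers all pinned positions as soon as there
     are at most [K] of them; the default [ord0] only pads it. *)
  have listed i : i \in pinned k s -> exists x, list_pinned s x = i.
    move=> i_in; have lt_iK : index i (enum (pinned k s)) < K.
      apply: (@leq_trans #|pinned k s|); last first.
        by apply: card_pinned; rewrite inE in good_s.
      by rewrite cardE index_mem mem_enum.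
    by exists (Ordinal lt_iK); rewrite ffunE nth_index // mem_enum.
  apply: (@inv_mx_pinned_inj _ k s s' (iso s * (iso s')^-1)%g).
  - by move=> i j; rewrite !isoP !permM !permKV eqG.
  - move=> i /listed [x <-]; rewrite permM.
    by have := eq_iso x; rewrite !alongE -eq_l => ->; rewrite permK.
  - move=> i ik; have /listed [x <-] : i \in pinned k s by rewrite !inE ik.
    by have := eq_val x; rewrite !alongE -eq_l.
rewrite -(card_in_imset code_inj).
apply: (@leq_trans #|finset.setX (permutation_graphs n.+1)
    [set: {ffun 'I_K -> 'I_n.+1} * {ffun 'I_K -> 'I_n.+1} * {ffun 'I_K -> 'I_n.+1}]|).
  apply: subset_leq_card; apply/fintype.subsetP => _ /imsetP[s _ ->].
  by rewrite !inE /= imset_f.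
rewrite cardsX cardsT !card_prod !card_ffun !card_ord -!expnD.
by rewrite (_ : K + K + K = 27 * k.+1) // /K; lia.
Qed.

(** * Upper tail of the number of points of a random permutation in a rectangle *)

(** Adding a point to [L] multiplies the number of permutations that map [L]
    into [B] by [(#|B| - l) / (n - l)], which is at most [#|B| / n]. *)
Lemma card_perm_into n (L B : {set 'I_n}) :
  #|[set s : 'S_n | [forall i in L, s i \in B]]| * n ^ #|L| <= n`! * #|B| ^ #|L|.
Proof.
pose f (L : {set 'I_n}) := #|[set s : 'S_n | [forall i in L, s i \in B]]|.
rewrite -/(f L); elim: {L}#|L| {1 3}L (erefl #|L|) => [|l IH] L cL.
  by rewrite !expn0 !muln1 -card_Sn max_card.
have [x xL] : exists x, x \in L by apply/card_gt0P; rewrite cL.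
pose L' := (L :\ x)%SET.
have xL' : x \notin L' by rewrite !inE eqxx.
have cL' : #|L'| = l by apply/eqP; rewrite -eqSS -cL (cardsD1 x L) xL.
have fU y : y \notin L' -> f (y |: L')%SET =
    \sum_(s : 'S_n | [forall i in L', s i \in B]) (s y \in B : nat).
  move=> yL'; rewrite -big_mkcondr /= sum1dep_card /f; apply: eq_card => s.
  rewrite !inE; apply/forall_inP/andP => [sB|[/forall_inP sB yB] i].
    split; last by apply: sB; rewrite !inE eqxx.
    by apply/forall_inP => i iL'; apply: sB; rewrite inE iL' orbT.
  by rewrite !inE => /orP[/eqP -> //|/andP[? ?]]; apply: sB; rewrite !inE; apply/andP.
(* All points outside [L'] are exchangeable, so that the count for [L] is an
   average over them. *)
have f_swap y : y \notin L' -> f (y |: L')%SET = f L.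
  move=> yL'; rewrite -(finset.setD1K xL) -/L' !fU //.
  rewrite (reindex_inj (mulgI (tperm x y))) /=; apply: eq_big => s.
    apply: eq_forallb_in => i iL'; rewrite permM tpermD //.
      by apply: contraNneq xL' => ->.
    by apply: contraNneq yL' => ->.
  by rewrite permM tpermR.
have ln : l < n by rewrite -cL -[X in _ <= X]card_ord max_card.
have step : f L * (n - l) = f L' * (#|B| - l).
  have -> : n - l = #|~: L'|%SET by have := cardsC L'; rewrite card_ord; lia.
  rewrite mulnC -sum_nat_const.
  have -> : \sum_(y in (~: L')%SET) f L = \sum_(y in (~: L')%SET)
      \sum_(s : 'S_n | [forall i in L', s i \in B]) (s y \in B : nat).
    by apply: eq_bigr => y; rewrite inE => yL'; rewrite -(f_swap y) // fU.
  rewrite exchange_big /= /f -sum1dep_card big_distrl /=.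
  apply: eq_bigr => s /forall_inP sB; rewrite mul1n -big_mkcondr sum1dep_card.
  rewrite (_ : [set y in _ | _] = s @^-1: B :\: L')%SET; last first.
    by apply/setP => y; rewrite !inE.
  rewrite cardsD (_ : s @^-1: B :&: L' = L')%SET; last first.
    by apply/finset.setIidPr/fintype.subsetP => y /sB; rewrite inE.
  by rewrite cL' card_preimset //; exact: perm_inj.
have := IH L' cL'.
have fLn : f L * n <= f L' * #|B|.
  have bn : #|B| <= n by rewrite -[X in _ <= X]card_ord max_card.
  have nl : 0 < n - l by lia.
  rewrite -(leq_pmul2r nl) mulnAC step -mulnA -[X in _ <= X]mulnA leq_mul2l.
  by rewrite mulnBl mulnBr leq_sub2l ?orbT // mulnC leq_mul2l bn orbT.
rewrite !expnS mulnA => IHL; apply: leq_trans (leq_mul fLn (leqnn _)) _.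
by rewrite mulnAC [X in _ <= X]mulnCA mulnC leq_mul2l IHL orbT.
Qed.

Lemma leq_expn_ffact t l : (t - l) ^ l <= t ^_ l.
Proof.
rewrite ffact_prod -[X in _ ^ X]card_ord -prod_nat_const leq_prod // => i _.
by have := ltn_ord i; lia.
Qed.

Lemma leq_ffact_expn t l : t ^_ l <= t ^ l.
Proof.
rewrite ffact_prod -[X in _ ^ X]card_ord -prod_nat_const leq_prod // => i _.
by rewrite leq_subr.
Qed.

(** The method of factorial moments: count the pairs of a permutation and a set
    of [l] points of [A] that it sends into [B], with [card_perm_into]. *)
Lemma card_hits_tail n (A B : {set 'I_n}) l t :
  #|[set s : 'S_n | t <= #|[set i in A | s i \in B]| ]| * ((t - l) * n) ^ l <=
  n`! * (#|A| * #|B|) ^ l.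
Proof.
pose hits (s : 'S_n) := [set i in A | s i \in B].
set bad := [set s | _]%SET.
have subsets_le : #|bad| * 'C(t, l) <= \sum_(s : 'S_n) 'C(#|hits s|, l).
  rewrite -sum_nat_const [X in _ <= X](bigID (mem bad)) /=.
  apply: leq_trans (leq_addr _ _); apply: leq_sum => s; rewrite inE.
  exact: leq_bin2l.
have swap : (\sum_(s : 'S_n) 'C(#|hits s|, l)) * n ^ l <= 'C(#|A|, l) * (n`! * #|B| ^ l).
  under eq_bigr => s _ do rewrite -cards_draws -sum1dep_card big_mkcond /=.
  rewrite exchange_big /= -cards_draws -sum1dep_card !big_distrl /= [X in _ <= X]big_mkcond /=.
  apply: leq_sum => L _.
  have [/andP[LA /eqP cL]|nL] := boolP ((L \subset A) && (#|L| == l)).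
    apply: leq_trans (_ : _ <= n`! * #|B| ^ #|L|) _; last by rewrite cL mul1n.
    apply: leq_trans (card_perm_into L B); rewrite cL leq_mul2r.
    apply/orP; right; rewrite -sum1dep_card [X in _ <= X]big_mkcond /=.
    apply: leq_sum => s _; case: andP => // -[/fintype.subsetP Lh _].
    by rewrite ifT //; apply/forall_inP => i /Lh; rewrite inE => /andP[].
  rewrite big1 // => s _; case: andP => // -[/fintype.subsetP Lh cL].
  case/negP: nL; rewrite cL andbT; apply/fintype.subsetP => i /Lh.
  by rewrite inE => /andP[].
have := leq_expn_ffact t l; have := leq_ffact_expn #|A| l.
rewrite -!bin_ffact !expnMn => hA ht.
apply: (@leq_trans (#|bad| * ('C(t, l) * l`! * n ^ l))).
  by rewrite leq_mul2l leq_mul2r ht !orbT.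
apply: (@leq_trans ('C(#|A|, l) * (n`! * #|B| ^ l) * l`!)).
  rewrite [X in X <= _](_ : _ = (#|bad| * 'C(t, l) * n ^ l) * l`!); last by lia.
  rewrite leq_mul2r; apply/orP; right; apply: leq_trans swap.
  by rewrite leq_mul2r subsets_le orbT.
rewrite [X in X <= _](_ : _ = n`! * ('C(#|A|, l) * l`! * #|B| ^ l)); last by lia.
by rewrite leq_mul2l leq_mul2r hA !orbT.
Qed.

(** * Few permutation graphs are unbalanced *)

Definition cell p n L (s : 'S_n) (i : 'I_n) : 'I_p.+1 * 'I_p.+1 :=
  (inord (i %/ L), inord (s i %/ L)).

(** With [m := p.+1], no cell contains more than a proportion
    [1 / m ^ 2 + 1 / m ^ 3] of the points. *)
Definition balanced p n L (s : 'S_n) : bool :=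
  [forall a : 'I_p.+1 * 'I_p.+1,
    #|[set i | cell p L s i == a]| * p.+1 ^ 3 <= n * p.+2].

Definition same_line m (a b : 'I_m * 'I_m) : bool := (a.1 == b.1) || (a.2 == b.2).

(** Once two cells are in the same row, or in the same column, three
    coordinates are enough to describe both. *)
Lemma card_same_line m :
  #|[set p : ('I_m * 'I_m) * ('I_m * 'I_m) | same_line p.1 p.2]| <= 2 * m ^ 3.
Proof.
have le_cube (f : ('I_m * 'I_m) * ('I_m * 'I_m) -> 'I_m * 'I_m * 'I_m)
      (A : {set ('I_m * 'I_m) * ('I_m * 'I_m)}) :
    {in A &, injective f} -> #|A| <= m ^ 3.
  move=> f_inj; rewrite -(card_in_imset f_inj); apply: leq_trans (max_card _) _.
  by rewrite !card_prod !card_ord; lia.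
rewrite (_ : [set p | _] = [set p : ('I_m * 'I_m) * ('I_m * 'I_m) | p.1.1 == p.2.1]
    :|: [set p | p.1.2 == p.2.2])%SET; last by apply/setP => p; rewrite !inE.
apply: leq_trans (leq_card_setU _ _) _; rewrite mul2n -addnn leq_add //.
  apply: (le_cube (fun p => (p.1.1, p.1.2, p.2.2))).
  by move=> [[a b] [c d]] [[a' b'] [c' d']]; rewrite !inE /= => /eqP <- /eqP <- [-> -> ->].
apply: (le_cube (fun p => (p.1.1, p.1.2, p.2.1))).
by move=> [[a b] [c d]] [[a' b'] [c' d']]; rewrite !inE /= => /eqP <- /eqP <- [-> -> ->].
Qed.

(** Large enough for [p.+1] strips to cover ['I_n]. *)
Definition strip_width p n := (n %/ p.+1).+1.

Lemma card_divn_fiber n L (f : 'I_n -> 'I_n) a : injective f -> 0 < L ->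
  #|[set i | f i %/ L == a]| <= L.
Proof.
move=> f_inj L0; pose h (i : 'I_n) : 'I_L := Ordinal (ltn_pmod (f i) L0).
rewrite -(@card_in_imset _ _ h); first by apply: leq_trans (max_card _) _; rewrite card_ord.
move=> i j; rewrite !inE => /eqP ia /eqP ja [eq_mod].
by apply/f_inj/val_inj; rewrite /= (divn_eq (f i) L) (divn_eq (f j) L) ia ja eq_mod.
Qed.

(** Here [t] is more than a balanced cell may contain, and [l] is a
    quarter of the allowed excess [n / m ^ 3].  Hence [(t - l) / n] is at least
    [(1 + 3 / (4 * m)) / m ^ 2], while [(L / n) ^ 2] tends to [1 / m ^ 2]; the
    assumption on [n] makes the rounding in [L] harmless. *)
Lemma tail_ratio m n L t l : 0 < m -> 3 * m * (2 * m + 1) <= n ->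
  L = (n %/ m).+1 -> n * m.+1 < t * m ^ 3 -> l = n %/ (4 * m ^ 3) ->
  L ^ 2 * (4 * m + 2) <= (4 * m + 1) * ((t - l) * n).
Proof.
move=> m0 n_big eqL n_lt eql.
have Lm : L * m <= n + m by rewrite eqL mulSn addnC leq_add2r leq_divM.
have lm : l * (4 * m ^ 3) <= n by rewrite eql leq_divM.
have tl : n * (4 * m + 3) <= 4 * m ^ 3 * (t - l).
  rewrite mulnBr; move: (m ^ 3) n_lt lm => c; lia.
have m3 : 0 < 4 * m ^ 3 by rewrite muln_gt0 expn_gt0 m0.
rewrite -(leq_pmul2l m3).
apply: (@leq_trans (4 * m * (4 * m + 2) * (n + m) ^ 2)).
  have : (L * m) ^ 2 <= (n + m) ^ 2 by rewrite leq_sqr.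
  rewrite expnMn => /(leq_mul (leqnn (4 * m * (4 * m + 2)))).
  by apply: leq_trans; lia.
apply: (@leq_trans ((4 * m + 1) * (n * (4 * m + 3) * n))); last first.
  rewrite [X in _ <= X](_ : _ = (4 * m + 1) * (4 * m ^ 3 * (t - l) * n)); last by lia.
  by rewrite leq_mul2l leq_mul2r tl !orbT.
have : m * m * (3 * m * (2 * m + 1)) <= m * m * n by rewrite leq_mul2l n_big orbT.
have : m * n * (3 * m * (2 * m + 1)) <= m * n * n by rewrite leq_mul2l n_big orbT.
have : n * (3 * m * (2 * m + 1)) <= n * n by rewrite leq_mul2l n_big orbT.
move: n_big; rewrite -!mulnn; lia.
Qed.

(** Union bound over the cells; [card_hits_tail] and [tail_ratio] make each
    term exponentially small in [n]. *)
Lemma card_unbalanced p n (m := p.+1) : 3 * m * (2 * m + 1) <= n ->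
  #|[set s : 'S_n | ~~ balanced p (strip_width p n) s]|
      * (4 * m + 2) ^ (n %/ (4 * m ^ 3)) <=
    m ^ 2 * n`! * (4 * m + 1) ^ (n %/ (4 * m ^ 3)).
Proof.
move=> n_big; set L := strip_width p n; set l := n %/ (4 * m ^ 3).
have n0 : 0 < n by apply: leq_trans n_big; rewrite !muln_gt0.
pose t := (n * m.+1 %/ m ^ 3).+1.
have m3 : 0 < m ^ 3 by rewrite expn_gt0.
have t_lt : n * m.+1 < t * m ^ 3 by rewrite -ltn_divLR.
pose A a := [set i : 'I_n | i %/ L == a].
pose over (a : 'I_m * 'I_m) :=
  [set s : 'S_n | t <= #|[set i in A a.1 | s i \in A a.2]|].
have over_le a : #|over a| * (4 * m + 2) ^ l <= n`! * (4 * m + 1) ^ l.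
  have ratio := tail_ratio (ltn0Sn p) n_big (erefl : L = (n %/ m).+1) t_lt (erefl l).
  have tail := card_hits_tail (A a.1) (A a.2) l t.
  have cA b : #|A b| <= L by apply: (@card_divn_fiber n L id).
  have tln : 0 < ((t - l) * n) ^ l.
    rewrite expn_gt0; apply/orP; left.
    by move: ratio; case: ((t - l) * n) => //; rewrite muln0 leqn0 muln_eq0 expn_eq0.
  rewrite -(leq_pmul2r tln) mulnAC.
  apply: leq_trans (leq_mul tail (leqnn _)) _.
  rewrite -!mulnA leq_mul2l -!expnMn; apply/orP; right.
  have [->//|l0] := posnP l; rewrite leq_exp2r //; apply: leq_trans ratio.
  by rewrite leq_mul2r -mulnn leq_mul ?orbT.
have sub_over : [set s : 'S_n | ~~ balanced p L s] \subset \bigcup_a over a.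
  apply/fintype.subsetP => s; rewrite inE => /forallPn [a]; rewrite -ltnNge => a_big.
  apply/finset.bigcupP; exists a => //; rewrite inE ltn_divLR //.
  apply: leq_trans a_big _; rewrite leq_mul2r; apply/orP; right.
  apply: subset_leq_card; apply/fintype.subsetP => i; rewrite !inE => /eqP <- /=.
  have lt_m (j : 'I_n) : j %/ L < m.
    rewrite ltn_divLR //; apply: leq_trans (ltn_ord j) _.
    by rewrite mulnC ltnW // ltn_ceil.
  by rewrite !inordK ?eqxx.
apply: (@leq_trans ((\sum_a #|over a|) * (4 * m + 2) ^ l)).
  rewrite leq_mul2r; apply/orP; right; apply: leq_trans (subset_leq_card sub_over) _.
  elim/big_rec2: _ => [|a x B _ IH]; first by rewrite cards0.
  by apply: leq_trans (leq_card_setU _ _) _; rewrite leq_add2l.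
rewrite big_distrl /=; apply: leq_trans (leq_sum _ (fun a _ => over_le a)) _.
by rewrite sum_nat_const card_prod card_ord mulnn mulnA.
Qed.

Lemma nat_sqrt_exists n : exists k, k ^ 2 <= n < k.+1 ^ 2.
Proof.
elim: n => [|n [k /andP[kn nk]]]; first by exists 0.
have [lt_k|le_k] := ltnP n.+1 (k.+1 ^ 2).
  by exists k; rewrite lt_k leqW.
by exists k.+1; rewrite le_k -!mulnn in nk *; lia.
Qed.

Section Ratio.
Local Open Scope ring_scope.
Variable R : realType.

(** With [y := sqrt k.+1], the left side is at most
    [expR (4 * y) ^+ (27 * y ^+ 2) = expR (108 * y ^+ 3)] as [n <= y ^+ 4], while
    [y ^+ 4 <= 4 * n]. *)
Lemma sub_exponential (eps : R) : 0 < eps -> exists2 K : R, 0 <= K &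
  forall n k, (0 < n)%N -> (k ^ 2 <= n < k.+1 ^ 2)%N ->
    (n ^ (27 * k.+1))%:R <= expR (K + eps * n%:R).
Proof.
move=> eps0; pose e := eps / 4; have e0 : 0 < e by rewrite divr_gt0.
pose K := 108 * (108 / e) ^+ 3.
exists K; first by rewrite mulr_ge0 // exprn_ge0 // divr_ge0 // ltW.
move=> n k n0 /andP[kn nk]; pose y := Num.sqrt (k.+1%:R : R).
have y0 : 0 <= y by exact: sqrtr_ge0.
have y2 : y ^+ 2 = k.+1%:R by rewrite sqr_sqrtr.
have n_le : n%:R <= expR (4 * y).
  rewrite expRM_natl; apply: (@le_trans _ _ (y ^+ 4)).
    rewrite (_ : y ^+ 4 = (k.+1 ^ 2)%:R); first by rewrite ler_nat ltnW.
    by rewrite natrX -y2 -exprM.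
  apply: lerXn2r; rewrite ?nnegrE ?expR_ge0 //.
  by apply: le_trans (expR_ge1Dx y); rewrite lerDr.
rewrite natrX; apply: (@le_trans _ _ (expR (4 * y) ^+ (27 * k.+1))).
  by apply: lerXn2r; rewrite ?nnegrE ?expR_ge0.
rewrite -expRM_natl ler_expR natrM -y2.
have k0 : (0 < k)%N by case: k kn nk {y y0 y2 n_le} => //; lia.
have y4 : e * y ^+ 4 <= eps * n%:R.
  rewrite (_ : y ^+ 4 = (k.+1 ^ 2)%:R); last by rewrite natrX -y2 -exprM.
  have : ((k.+1 ^ 2)%:R <= 4 * n%:R :> R).
    by rewrite -natrM ler_nat -!mulnn in kn *; nia.
  by rewrite -(ler_pM2l e0) => /le_trans; apply; rewrite mulrA divfK.
(* Compare [108 * y ^+ 3] with [e * y ^+ 4]: the quartic term wins as soon as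
   [y] exceeds [108 / e], and [K] covers the other values of [y]. *)
have [le_y|lt_y] := lerP y (108 / e).
  have : y ^+ 3 <= (108 / e) ^+ 3 by apply: lerXn2r; rewrite ?nnegrE // divr_ge0 // ltW.
  have : 0 <= eps * n%:R by rewrite mulr_ge0 // ltW.
  rewrite /K; set z := (108 / e) ^+ 3; nra.
have : 108 * y ^+ 3 <= e * y ^+ 4.
  rewrite ltr_pdivrMr // in lt_y.
  rewrite (exprS y 3) [X in _ <= X]mulrA; apply: ler_wpM2r; first exact: exprn_ge0.
  by rewrite mulrC ltW.
have : 0 <= K by rewrite mulr_ge0 // exprn_ge0 // divr_ge0 // ltW.
nra.
Qed.

(** The unbalanced permutations are exponentially rare, and dividing by the
    number of permutation graphs instead of [n!] costs only the subexponential
    factor of [fact_le_permutation_graphs]. *)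
Lemma unbalanced_ratio p : exists K r : R, [/\ 0 <= K, 0 < r < 1 &
  forall n, (3 * p.+1 * (2 * p.+1 + 1) <= n)%N ->
    #|[set s : 'S_n | ~~ balanced p (strip_width p n) s]|%SET%:R <=
      K * r ^+ n * #|permutation_graphs n|%:R].
Proof.
set m := p.+1; have m0 : 0 < m%:R :> R by rewrite ltr0n.
pose rho : R := (4 * m + 1)%:R / (4 * m + 2)%:R.
have den0 : 0 < (4 * m + 2)%:R :> R by rewrite ltr0n addn2.
have rho0 : 0 < rho by rewrite divr_gt0 // ltr0n addn1.
have rho1 : rho < 1 by rewrite ltr_pdivrMr // mul1r ltr_nat; lia.
pose c := - ln rho; have c0 : 0 < c by rewrite oppr_gt0 ln_lt0 // rho0.
have expc : expR (- c) = rho by rewrite opprK lnK.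
pose d := c / (4 * m ^ 3)%:R.
have m3 : 0 < (4 * m ^ 3)%:R :> R by rewrite ltr0n muln_gt0 expn_gt0.
have d0 : 0 < d by rewrite divr_gt0.
have [K K0 KP] := @sub_exponential (d / 2) (divr_gt0 d0 (ltr0Sn R 1)).
exists (2 * m%:R ^+ 2 * expR (K + c)), (expR (- (d / 2))); split.
- by rewrite mulr_ge0 ?expR_ge0 // mulr_ge0 // exprn_ge0.
- by rewrite expR_gt0 expR_lt1 oppr_lt0 divr_gt0.
move=> n n_big; have n0 : (0 < n)%N by apply: leq_trans n_big; rewrite !muln_gt0.
have [k kn] := nat_sqrt_exists n; set l := (n %/ (4 * m ^ 3))%N.
have := @card_unbalanced p n n_big; rewrite -/m -/l.
set u := #|_| => /=; rewrite -(ler_nat R) !natrM !natrX => unb.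
have unb_rho : u%:R <= m%:R ^+ 2 * n`!%:R * rho ^+ l.
  by rewrite expr_div_n mulrA ler_pdivlMr ?exprn_gt0.
have rho_l : rho ^+ l <= expR (c - d * n%:R).
  have dn : d * n%:R <= c * (l%:R + 1).
    rewrite /d mulrAC ler_pdivrMr // -mulrA ler_pM2l // natr1 -natrM ler_nat.
    by rewrite ltnW // ltn_ceil // muln_gt0 expn_gt0.
  by rewrite -expc -expRM_natl ler_expR; lra.
have facts : n`!%:R <= 2 * #|permutation_graphs n|%:R * expR (K + d / 2 * n%:R) :> R.
  apply: (@le_trans _ _ (2 * #|permutation_graphs n|%:R * (n ^ (27 * k.+1))%:R)).
    rewrite -!natrM ler_nat -mulnA; apply: fact_le_permutation_graphs => //.
    by case/andP: kn => _ /ltnW.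
  by apply: ler_wpM2l; [rewrite -natrM|exact: KP].
apply: le_trans unb_rho _; rewrite -expRM_natl.
apply: (@le_trans _ _ (m%:R ^+ 2 * (2 * #|permutation_graphs n|%:R * expR (K + d / 2 * n%:R))
    * expR (c - d * n%:R))).
  by apply: ler_pM; rewrite ?mulr_ge0 ?exprn_ge0 ?ler0n ?(ltW rho0) // ler_wpM2l // exprn_ge0.
rewrite [X in _ <= X](_ : _ = m%:R ^+ 2 * (2 * #|permutation_graphs n|%:R)
   * (expR (K + c) * expR (n%:R * - (d / 2)))); last by ring.
rewrite -mulrA -mulrA -[X in _ <= X]mulrA -!expRD.
by rewrite (_ : K + d / 2 * n%:R + (c - d * n%:R) = K + c + n%:R * - (d / 2)) //; field.
Qed.

End Ratio.

Definition balanced_graphs p n : {set ugraph n} :=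
  [set inversion_graph s | s in [set s : 'S_n | balanced p (strip_width p n) s]]%SET.

Lemma card_setD_balanced_graphs p n :
  (#|permutation_graphs n :\: balanced_graphs p n| <=
    #|[set s : 'S_n | ~~ balanced p (strip_width p n) s]|)%SET%N.
Proof.
apply: leq_trans (leq_imset_card (@inversion_graph n) _).
apply: subset_leq_card; apply/fintype.subsetP => _ /setDP[/imsetP[s _ ->] s_bad].
by apply: imset_f; rewrite inE; apply: contra s_bad => s_good; apply: imset_f; rewrite inE.
Qed.

(** * Matching two colourings *)

(** In a permutation with the most matches, no mismatched [x] and [y] can
    satisfy [c1 (pi x) = c2 y], since exchanging their images would give one
    match more.  So, if some [y] of [c2]-colour [a] is mismatched, every [x] with
    [c1 (pi x) = a] is matched, and only the surplus of [a] on the side of [c2]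
    stays mismatched. *)
Lemma exists_matching (X C : finType) (c1 c2 : X -> C) : exists pi : {perm X},
  #|[set x | c1 (pi x) != c2 x]| <=
    \sum_(a : C) (#|[set x | c2 x == a]| - #|[set x | c1 x == a]|).
Proof.
pose hits (pi : {perm X}) := #|[set x | c1 (pi x) == c2 x]%SET|.
have [pi _ pi_max] := @arg_maxnP _ 1%g xpredT hits isT.
exists pi; set miss := [set x | _]%SET.
have no_swap x y : x \in miss -> y \in miss -> c1 (pi x) != c2 y.
  rewrite !inE => mx my; apply/negP => /eqP xy.
  have := pi_max (tperm x y * pi)%g isT; rewrite /geq /= leqNgt => /negP; apply.
  apply: proper_card; apply/properP; split.
    apply/fintype.subsetP => z; rewrite !inE permM => /eqP hz.
    rewrite tpermD ?hz //; apply/eqP => ez; move: hz; rewrite -ez.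
      by move/eqP; rewrite (negbTE mx).
    by move/eqP; rewrite (negbTE my).
  by exists y; rewrite !inE // permM tpermR xy.
have -> : #|miss| = \sum_(a : C) #|[set x in miss | c2 x == a]|%SET.
  rewrite -sum1_card (partition_big c2 xpredT) //=.
  by apply: eq_bigr => a _; rewrite -sum1dep_card; apply: eq_bigl => x.
apply: leq_sum => a _.
have [->|] := posnP #|[set x in miss | c2 x == a]%SET|; first by [].
rewrite card_gt0 => /set0Pn [y]; rewrite inE => /andP[my /eqP ya].
have hit_a x : c1 (pi x) = a -> x \notin miss.
  by move=> xa; apply/negP => mx; have := no_swap x y mx my; rewrite xa ya eqxx.
have -> : #|[set x | c1 x == a]|%SET = #|[set x | c1 (pi x) == a]|%SET.
  rewrite -(card_preimset _ (@perm_inj _ pi)).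
  by apply: eq_card => x; rewrite !inE.
have : #|[set x | c1 (pi x) == a]|%SET <= #|[set x | c2 x == a] :\: miss|%SET.
  apply: subset_leq_card; apply/fintype.subsetP => x; rewrite !inE => /eqP xa.
  have := hit_a x xa; rewrite inE negbK => /eqP <-.
  by rewrite xa !eqxx.
have := cardsID miss [set x | c2 x == a]%SET.
have -> : ([set x | c2 x == a] :&: miss = [set x in miss | c2 x == a])%SET.
  by apply/setP => x; rewrite !inE andbC.
move=> <-; set u := #|_ :\: _|; set v := #|_|; set w := #|_|; lia.
Qed.

Lemma card_divn_class n M (C : eqType) (f : nat -> C) (a : C) : 0 < M ->
  #|[set k : 'I_(n * M) | f (k %/ M) == a]| = #|[set i : 'I_n | f i == a]| * M.
Proof.
move=> M0; rewrite -!sum1dep_card [in LHS]big_mkcond /=.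
rewrite -(big_mkord xpredT (fun k => if f (k %/ M) == a then 1 else 0)).
rewrite [in RHS]big_mkcond /=.
rewrite -(big_mkord xpredT (fun k => if f k == a then 1 else 0)).
rewrite big_nat_mul.
rewrite big_distrl /=; apply: eq_bigr => i _.
rewrite (eq_big_nat _ _ (F2 := fun=> if f i == a then 1 else 0)).
  by rewrite sum_nat_const_nat mulSn addnK mulnC.
move=> j /andP[ij ji]; rewrite (_ : j %/ M = i) //; apply/eqP.
by rewrite eqn_leq leq_divRL // ij -ltnS ltn_divLR // ji.
Qed.

(** * Measures of finite unions *)

Section FiniteUnions.
Local Open Scope ring_scope.
Local Open Scope classical_set_scope.
Local Open Scope ereal_scope.

Lemma bigsetU_finP (T : Type) (J : finType) (P : pred J) (F : J -> set T) x :
  (\big[setU/set0]_(i | P i) F i) x <-> exists2 i, P i & F i x.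
Proof.
rewrite -bigcup_seq_cond; split=> [[i /andP[_ Pi] Fi]|[i Pi Fi]]; exists i => //=.
by rewrite mem_index_enum.
Qed.

Lemma measure_bigsetU_le d (T : measurableType d) (R : realType)
    (mu : {measure set T -> \bar R}) (J : finType) (P : pred J) (F : J -> set T) :
  (forall i, measurable (F i)) ->
  mu (\big[setU/set0]_(i | P i) F i) <= \sum_(i | P i) mu (F i).
Proof.
move=> mF; pose K A x := measurable A /\ mu A <= x.
suff [] : K (\big[setU/set0]_(i | P i) F i) (\sum_(i | P i) mu (F i)) by [].
apply: (big_ind2 K) => [|A x B y [mA Ax] [mB By]|i _]; rewrite /K.
- by split; rewrite ?measure0.
- by split; [exact: measurableU|rewrite (le_trans (measureU2 mu _ _)) // leeD].
- by [].
Qed.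

Lemma measure_bigsetU d (T : measurableType d) (R : realType)
    (mu : {measure set T -> \bar R}) (J : finType) (F : J -> set T) :
  (forall i, measurable (F i)) -> trivIset setT F ->
  mu (\big[setU/set0]_i F i) = \sum_i mu (F i).
Proof.
move=> mF tF; rewrite -bigcup_seq measure_fin_bigcup //.
- by rewrite -fsbig_seq ?index_enum_uniq.
- exact: sub_trivIset tF.
Qed.

End FiniteUnions.

Section Analysis.
Local Open Scope ring_scope.
Local Open Scope classical_set_scope.
Local Open Scope ereal_scope.
Variable R : realType.

Local Notation I := (`[0%R, 1%R] : set R).
Local Notation leb := (@lebesgue_measure R).
Local Notation leb2 := (leb \x leb).

(** * Blocks of the unit interval *)

(** Open on the left, in accordance with the ceilings in [step_fun]. *)
Definition block N k : set R := `](k%:R / N%:R)%R, (k.+1%:R / N%:R)%R].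

Lemma blockE N k x : (0 < N)%N ->
  block N k x <-> (k%:R < N%:R * x <= k.+1%:R)%R.
Proof.
move=> N0; rewrite /block /= in_itv /= ltr_pdivrMr ?ltr0n // ler_pdivlMr ?ltr0n //.
by rewrite mulrC.
Qed.

Lemma leb_unit : leb I = 1.
Proof. by rewrite lebesgue_measure_itv /= lte_fin ltr01 oppr0 adde0. Qed.

Lemma measurable_block N k : measurable (block N k).
Proof. exact: measurable_itv. Qed.

Lemma block_sub01 N k x : (k < N)%N -> block N k x -> (0 < x <= 1)%R.
Proof.
move=> kN; have N0 : (0 < N)%N by exact: leq_trans kN.
have N0' : (0 < N%:R :> R)%R by rewrite ltr0n.
move=> /(blockE _ _ N0) /andP[kx xk]; apply/andP; split.
  by rewrite -(pmulr_rgt0 _ N0') (le_lt_trans _ kx).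
by rewrite -(ler_pM2l N0') mulr1 (le_trans xk) // ler_nat.
Qed.

Lemma block_subI N k : (k < N)%N -> block N k `<=` I.
Proof. by move=> kN x /(block_sub01 kN) /andP[/ltW x0 x1]; rewrite /= in_itv /= x0. Qed.

Lemma block_uniq N k l x : (0 < N)%N -> block N k x -> block N l x -> k = l.
Proof.
move=> N0 /(blockE _ _ N0) /andP[kx xk] /(blockE _ _ N0) /andP[lx xl].
have := lt_le_trans kx xl; have := lt_le_trans lx xk; rewrite !ltr_nat; lia.
Qed.

Lemma block_exists N x : (0 < N)%N -> (0 < x <= 1)%R ->
  exists k : 'I_N, block N k x.
Proof.
move=> N0 /andP[x0 x1]; have N0' : (0 < N%:R :> R)%R by rewrite ltr0n.
have [k ck] : exists k, Num.ceil (N%:R * x)%R = k.+1%:Z.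
  have : (0 < Num.ceil (N%:R * x)%R)%R by rewrite ceil_gt0 mulr_gt0.
  by case: (Num.ceil _) => // -[//|k] _; exists k.
have /andP[lo hi] : ((k%:Z%:~R : R) < N%:R * x <= (k.+1%:Z%:~R : R))%R.
  by move/eqP: ck; rewrite ceil_eq (_ : k.+1%:Z - 1 = k%:Z)%R //; lia.
have kN : (k < N)%N.
  by rewrite -(ltr_nat R); apply: lt_le_trans lo _; rewrite ler_piMr // ltW.
by exists (Ordinal kN); apply/blockE => //; rewrite lo hi.
Qed.

Lemma leb_block N k : (0 < N)%N -> leb (block N k) = (N%:R^-1)%:E.
Proof.
move=> N0; rewrite /block lebesgue_measure_itv /= lte_fin.
rewrite ltr_pM2r ?invr_gt0 ?ltr0n // ltr_nat ltnSn -EFinB -mulrBl.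
by rewrite -natrB // subSnn mul1r.
Qed.

(** The blocks are disjoint and miss only the point [0]. *)
Lemma leb_sum_blocks N (B : set R) : (0 < N)%N -> measurable B -> B `<=` I ->
  leb B = \sum_(k < N) leb (block N k `&` B).
Proof.
move=> N0 mB BI.
have mJ (k : 'I_N) : measurable (block N k `&` B).
  by apply: measurableI => //; exact: measurable_block.
rewrite -(measure_semi_additive_ord leb mJ) //=; last 2 first.
- move=> i j _ _ [x [[xi _] [xj _]]].
  by apply/val_inj; exact: block_uniq xi xj.
- by apply: bigsetU_measurable => k _; exact: mJ.
set U := \big[setU/set0]_(k < N) _.
have mU : measurable U by apply: bigsetU_measurable => k _; exact: mJ.
have UB : U `<=` B by move=> x /bigsetU_finP [k _ []].
rewrite (measureDI leb mB mU) (setIidr UB).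
rewrite [X in X + _](_ : _ = 0) ?add0e //.
apply: (@subset_measure0 _ _ _ leb _ ([set 0%R] : set R)) => //.
- exact: measurableD.
- move=> x [Bx nUx]; have := BI x Bx; rewrite /= in_itv /= => /andP[x0 x1].
  apply/eqP/negPn/negP => nx0; apply: nUx; apply/bigsetU_finP.
  have [|k xk] := @block_exists N x N0; last by exists k.
  by rewrite lt_neqAle eq_sym nx0 x0.
- exact: lebesgue_measure_set1.
Qed.

(** * Interval exchanges *)

(** Both sides are measures that agree on half-open intervals. *)
Lemma lebesgue_measure_shift (a : R) (A : set R) : measurable A ->
  leb ((fun x => x + a)%R @^-1` A) = leb A.
Proof.
have ma : measurable_fun [set: R] (fun x : R => (x + a)%R).
  by apply: measurable_funD => //; exact: measurable_cst.
pose mu := pushforward leb (fun x : R => (x + a)%R : measurableTypeR R).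
move=> mA; apply/esym; apply: (@lebesgue_measure_unique _ mu) => //= _ [[x y]] _ <-.
rewrite /mu /pushforward (_ : _ @^-1` _ = `](x - a)%R, (y - a)%R]); last first.
  by apply/seteqP; split => z /=; rewrite !in_itv /= ltrBlDr lerBrDr.
by rewrite !lebesgue_measure_itv /= !lte_fin ltrD2r -!EFinB opprB addrA subrK.
Qed.

(** The map that translates the [k]-th block onto the block [pi k] and fixes
    [0].  As a finite sum of indicators it is visibly measurable. *)
Definition exchange N (pi : 'S_N) (x : R) : R :=
  (x + \sum_(k < N) \1_(block N k) x * (((pi k)%:R - k%:R) / N%:R))%R.

Lemma measurable_exchange N (pi : 'S_N) : measurable_fun [set: R] (exchange pi).
Proof.
apply: measurable_funD => //; apply: measurable_sum => k.
apply: measurable_funM => //; apply: measurable_indic; exact: measurable_block.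
Qed.

Lemma exchange_block N (pi : 'S_N) (k : 'I_N) x : (0 < N)%N -> block N k x ->
  exchange pi x = (x + ((pi k)%:R - k%:R) / N%:R)%R.
Proof.
move=> N0 xk; rewrite /exchange (bigD1 k) //= indicE mem_set // mul1r big1 ?addr0 //.
move=> l lk; rewrite indicE memNset ?mul0r // => xl.
by move/eqP: lk; apply; apply/val_inj; exact: block_uniq xl xk.
Qed.

Lemma exchange0 N (pi : 'S_N) : exchange pi 0%R = 0%R.
Proof.
rewrite /exchange big1 ?addr0 // => k _; rewrite indicE memNset ?mul0r //.
by move=> /(block_sub01 (ltn_ord k)); rewrite ltxx.
Qed.

Lemma exchange_in_block N (pi : 'S_N) (k : 'I_N) x : (0 < N)%N -> block N k x ->
  block N (pi k) (exchange pi x).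
Proof.
move=> N0 xk; rewrite (exchange_block pi N0 xk); apply/blockE => //.
move/(blockE _ _ N0): xk.
rewrite mulrDr mulrCA divff ?pnatr_eq0 -?lt0n // mulr1 -!natr1.
by move=> /andP[? ?]; apply/andP; split; lra.
Qed.

Lemma exchangeK N (pi : 'S_N) : (0 < N)%N ->
  {in I, cancel (exchange pi) (exchange pi^-1%g)}.
Proof.
move=> N0 x /set_mem; rewrite /= in_itv /= => /andP[x0 x1].
have [->|nx0] := eqVneq x 0%R; first by rewrite !exchange0.
have [|k xk] := @block_exists N x N0; first by rewrite lt_neqAle eq_sym nx0 x0.
rewrite (exchange_block _ N0 (exchange_in_block pi N0 xk)) permK.
by rewrite (exchange_block _ N0 xk); lra.
Qed.

(** Block by block the map is a translation, and [pi] permutes the blocks. *)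
Lemma lebesgue_preserving_exchange N (pi : 'S_N) : (0 < N)%N ->
  lebesgue_preserving (exchange pi).
Proof.
move=> N0; have homI : {homo exchange pi : x / I x >-> I x}.
  move=> x; rewrite /= in_itv /= => /andP[x0 x1].
  have [->|nx0] := eqVneq x 0%R; first by rewrite exchange0 in_itv /= lexx ler01.
  have [|k xk] := @block_exists N x N0; first by rewrite lt_neqAle eq_sym nx0 x0.
  exact: (block_subI (ltn_ord _) (exchange_in_block pi N0 xk)).
split => //; first exact: measurable_funTS (measurable_exchange pi).
move=> A mA AI.
have mpre : measurable (exchange pi @^-1` A).
  by rewrite -[X in measurable X]setTI; exact: measurable_exchange.
rewrite (leb_sum_blocks N0 (measurableI _ _ (measurable_itv _) mpre)); last exact: subIsetl.
rewrite [RHS](leb_sum_blocks N0 mA AI) [RHS](reindex_inj (@perm_inj _ pi)) /=.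
apply: eq_bigr => k _; set a := (((pi k)%:R - k%:R) / N%:R : R)%R.
rewrite -[RHS](lebesgue_measure_shift a); last first.
  by apply: measurableI => //; exact: measurable_block.
congr (leb _); apply/seteqP; split => x /=.
  move=> [xk [_ Ax]]; rewrite -(exchange_block pi N0 xk); split => //.
  exact: exchange_in_block.
move=> [xk Ax]; have xk' : block N k x.
  move/(blockE _ _ N0): xk => xk; apply/blockE => //; move: xk.
  rewrite mulrDr mulrCA divff ?pnatr_eq0 -?lt0n // mulr1 -!natr1.
  by move=> /andP[? ?]; apply/andP; split; lra.
split => //; rewrite /preimage /= (exchange_block pi N0 xk'); split => //.
exact: (block_subI (ltn_ord k)) xk'.
Qed.

Lemma invertible_exchange N (pi : 'S_N) : (0 < N)%N ->
  invertible_lebesgue_preserving (exchange pi).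
Proof.
move=> N0; split; first exact: lebesgue_preserving_exchange.
exists (exchange pi^-1%g); first exact: lebesgue_preserving_exchange.
split; first exact: exchangeK.
by move=> x xI; have := @exchangeK N pi^-1%g N0 x xI; rewrite invgK.
Qed.

(** * Colouring blocks by a measurable partition *)

Lemma compact_disjoint_separated (K L : set R) :
  compact K -> closed L -> K `&` L = set0 ->
  \forall M \near \oo, forall x y, K x -> L y -> (M.+1%:R^-1 <= `|x - y|)%R.
Proof.
move=> cK cL KL0.
have near_cover := (compact_near_coveringP K).1 cK.
have := @near_cover nat \oo
  (fun M x => forall y, L y -> (M.+1%:R^-1 <= `|x - y|)%R) _.
move=> /(_ _)[|n _ nP]; last by exists n => // M nM x y Kx; exact: nP.
move=> x Kx; have nLx : (~` L) x.
  by move=> Lx; have : (K `&` L) x by []; rewrite KL0.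
have [e /= e0 eL] : nbhs_ball x (~` L).
  by apply/nbhs_ballP; apply: open_nbhs_nbhs; split => //; rewrite openC.
have e20 : (0 < e / 2)%R by rewrite divr_gt0.
exists (ball x (e / 2), [set M | (M.+1%:R^-1 < e / 2)%R]).
  by split; [exact: nbhsx_ballx|exact: (near_infty_natSinv_lt (PosNum e20))].
move=> [x' M] /= [xx' Me] y Ly; rewrite leNgt; apply/negP => yx'.
apply: (eL y) => //; rewrite /ball /= in xx' *.
rewrite (splitr e) (le_lt_trans (ler_distD x' _ _)) // ltrD //.
exact: lt_trans yx' Me.
Qed.

(** By inner regularity each [F a] contains a compact set [K a] of almost the
    same measure.  These finitely many disjoint compact sets are at positive
    distance from each other, so a short enough block meets at most one of
    them. *)
Lemma block_colouring (C : finType) (c0 : C) (F : C -> set R) (eps : R) :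
  (0 < eps)%R -> (forall a, measurable (F a)) -> (forall a, F a `<=` I) ->
  trivIset [set: C] F ->
  exists (M : nat) (c : nat -> C) (E : set R),
    [/\ (0 < M)%N, measurable E, E `<=` I, leb E <= eps%:E &
        forall a j x, F a x -> block M j x -> ~ E x -> c j = a].
Proof.
move=> eps0 mF FI tF.
have C0 : (0 < #|C|)%N by apply/card_gt0P; exists c0.
have eC0 : (0 < eps / #|C|%:R)%R by rewrite divr_gt0 // ltr0n.
have finF a : leb (F a) < +oo.
  apply: (@le_lt_trans _ _ (leb I)); last by rewrite leb_unit ltry.
  by apply: le_measure; [rewrite inE; exact: mF|rewrite inE; exact: measurable_itv|exact: FI].
have [K KP] := choice (fun a => lebesgue_regularity_inner (mF a) (finF a) eC0).
have cK a : compact (K a) by have [] := KP a.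
have KF a : K a `<=` F a by have [] := KP a.
have mK a : measurable (K a).
  by apply: closed_measurable; apply: compact_closed => //; exact: cK.
have [n _ nP] : \forall M \near \oo, forall ab : C * C, ab.1 != ab.2 -> forall x y,
    K ab.1 x -> K ab.2 y -> (M.+1%:R^-1 <= `|x - y|)%R.
  apply: filter_forall => -[a b] /=.
  have [->|ab] := eqVneq a b; first exact: nearW.
  have := @compact_disjoint_separated (K a) (K b) (cK a) (compact_closed _ (cK b)).
  move=> /(_ _)[||m _ mP].
  - exact: Rhausdorff.
  - rewrite -subset0 => x [/KF Fa /KF Fb]; move/eqP: ab; apply.
    by apply: tF => //; exists x.
  - by exists m => // M /mP MP _.
pose c j := if pselect (exists a, block n.+1 j `&` K a !=set0) is left h
  then projT1 (cid h) else c0.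
pose E := \big[setU/set0]_(a : C) (F a `\` K a).
exists n.+1, c, E; split => //.
- by apply: bigsetU_measurable => a _; exact: measurableD.
- by move=> x /bigsetU_finP[a _ [/FI]].
- apply: le_trans.
    by apply: (@measure_bigsetU_le _ _ _ leb) => a; exact: measurableD (mF a) (mK a).
  apply: (@le_trans _ _ (\sum_(a : C) (eps / #|C|%:R)%:E)).
    by apply: lee_sum => a _; apply: ltW; have [] := KP a.
  by rewrite sumEFin sumr_const -[(_ *+ _)%R]mulr_natr divfK // pnatr_eq0 -lt0n.
move=> a j x Fx xj nEx.
have Kx : K a x.
  by apply: contrapT => nKx; apply: nEx; apply/bigsetU_finP; exists a.
rewrite /c; case: pselect => [h|[]]; last by exists a, x.
case: cid => b /= [y [yj Ky]]; apply/eqP/negPn/negP => ba.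
have := nP n (leqnn n) (b, a) ba y x Ky Kx; rewrite leNgt => /negP; apply.
move: xj yj => /(blockE _ _ (ltn0Sn n)) /andP[x1 x2] /(blockE _ _ (ltn0Sn n)) /andP[y1 y2].
rewrite -(@ltr_pM2l _ n.+1%:R) ?ltr0n // divff ?pnatr_eq0 //.
rewrite -[X in (X * _)%R]ger0_norm // -normrM mulrBr ltr_norml.
rewrite -natr1 in x2 y2.
by apply/andP; split; lra.
Qed.

(** * Cut distance from agreeing colours *)

(** The cut norm is at most the norm in [L^1]. *)
Lemma cut_norm_le_measure (f : R * R -> R) (D : set (R * R)) :
  measurable_fun (I `*` I) f -> measurable D ->
  (forall z, (I `*` I) z -> `|f z| <= 1)%R ->
  (forall z, (I `*` I) z -> ~ D z -> f z = 0%R) ->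
  cut_norm f <= leb2 D.
Proof.
move=> mf mD f1 f0; apply: ge_ereal_sup => _ [S [T [mS mT SI TI ->]]].
have mST : measurable (S `*` T) by exact: measurableX.
have STI : S `*` T `<=` I `*` I by move=> z [/SI ? /TI ?].
have mII : measurable (I `*` I) by apply: measurableX; exact: measurable_itv.
have mfST : measurable_fun (S `*` T) (EFin \o f).
  by apply/measurable_EFinP; exact: measurable_funS mII STI mf.
apply: le_trans (le_abse_integral leb2 mST mfST) _.
apply: (@le_trans _ _ (\int[leb2]_(z in S `*` T) (\1_D z)%:E)).
  apply: ge0_le_integral => //.
  - exact: measurableT_comp.
  - by apply/measurable_EFinP; exact: measurable_indic.
  - move=> z STz; rewrite lee_fin indicE; have [Dz|nDz] := pselect (D z).
      by rewrite mem_set // f1 //; exact: STI.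
    by rewrite memNset // f0 ?normr0 //; exact: STI.
rewrite integral_indic //; apply: le_measure; rewrite ?inE //.
exact: measurableI.
Qed.

Lemma cut_dist_ge0 (u w : graphon R) : 0 <= cut_dist u w.
Proof.
apply: le_ereal_inf_tmp => _ [phi _ ->]; apply: ereal_sup_ubound.
exists set0, set0; split => //.
by rewrite set0X integral_set0 abse0.
Qed.

Lemma block_coarsen n M k (x : R) : (0 < n)%N -> (0 < M)%N ->
  block (n * M) k x -> block n (k %/ M) x.
Proof.
move=> n0 M0; have nM0 : (0 < n * M)%N by rewrite muln_gt0 n0.
have M0' : (0 < M%:R :> R)%R by rewrite ltr0n.
move=> /(blockE _ _ nM0) /andP[kx xk]; apply/blockE => //.
rewrite -(ltr_pM2r M0') -(ler_pM2r M0') -!natrM mulrAC -natrM; apply/andP; split.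
  by apply: le_lt_trans kx; rewrite ler_nat leq_divM.
by apply: (le_trans xk); rewrite ler_nat ltn_ceil.
Qed.

Lemma step_fun_block n (g : lgraph n) (i j : 'I_n) (x y : R) :
  block n i x -> block n j y -> step_fun g x y = (g i j)%:R%R.
Proof.
move=> xi yj; have n0 : (0 < n)%N by exact: leq_trans (ltn_ord i).
have ceil_block (k : 'I_n) (z : R) : block n k z -> Num.ceil (n%:R * z)%R = k.+1%:Z.
  move=> /(blockE _ _ n0) kz; apply/eqP; rewrite ceil_eq.
  by rewrite (_ : k.+1%:Z - 1 = k%:Z)%R //; lia.
rewrite /step_fun (ceil_block _ _ xi) (ceil_block _ _ yj).
congr ((nat_of_bool _)%:R)%R; apply/existsP/idP => [[k /existsP[l /and3P[]]]|gij].
  by move=> /eqP[/val_inj <-] /eqP[/val_inj <-].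
by exists i; apply/existsP; exists j; rewrite !eqxx.
Qed.

(** The blocks of colour [a] are contained in [F a] up to the exceptional set
    [E], which also absorbs the null set left out by the classes; hence no
    colour can have many more blocks than its share. *)
Lemma coloured_blocks (C : finType) (c0 : C) (F : C -> set R) (eps : R) :
  (0 < eps)%R -> (forall a, measurable (F a)) -> (forall a, F a `<=` I) ->
  trivIset [set: C] F -> (forall a, leb (F a) = (#|C|%:R^-1)%:E) ->
  exists (M : nat) (b : nat -> C) (E : set R),
    [/\ (0 < M)%N, [/\ measurable E, E `<=` I & leb E <= eps%:E],
        forall x j, I x -> block M j x -> ~ E x -> F (b j) x &
        forall a, (#|[set j : 'I_M | b j == a]%SET|%:R
                     <= M%:R * (#|C|%:R^-1 + eps))%R].
Proof.
move=> eps0 mF FI tF lebF.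
have mI : measurable I by exact: measurable_itv.
have C0 : (0 < #|C|)%N by apply/card_gt0P; exists c0.
have [M [b [E0 [M0 mE0 E0I lebE0 colE0]]]] := block_colouring c0 eps0 mF FI tF.
pose U := \big[setU/set0]_a F a.
have mU : measurable U by apply: bigsetU_measurable.
have UI : U `<=` I by move=> x /bigsetU_finP[a _ /FI].
have lebU : leb U = 1.
  rewrite /U measure_bigsetU // (eq_bigr (fun=> (#|C|%:R^-1)%:E)); last first.
    by move=> a _; exact: lebF.
  rewrite sumEFin sumr_const -[(_ *+ _)%R]mulr_natr mulVf //.
  by rewrite pnatr_eq0 -lt0n.
have null : leb (I `\` U) = 0.
  have := measureDI leb mI mU; rewrite (setIidr UI) => IU.
  have : leb I = leb (I `\` U) + leb U by exact: IU.
  rewrite leb_unit lebU.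
  case: (leb (I `\` U)) => [r| |] //; rewrite -EFinD => -[r0].
  by congr (_%:E); lra.
pose E := E0 `|` (I `\` U).
have mE : measurable E by apply: measurableU => //; exact: measurableD.
have lebE : leb E <= eps%:E.
  by rewrite /E (@measureU0 _ _ _ leb _ _ mE0 (measurableD mI mU) null).
have colE x j : I x -> block M j x -> ~ E x -> F (b j) x.
  move=> Ix xj nEx; have [a Fx] : exists a, F a x.
    apply: contrapT => nF; apply: nEx; right; split => // /bigsetU_finP[a _ Fx].
    by apply: nF; exists a.
  by rewrite (colE0 a j x) // => E0x; apply: nEx; left.
exists M, b, E; split => //; first by split => // x [/E0I|[]].
move=> a; have M0' : (0 < M%:R :> R)%R by rewrite ltr0n.
pose B : set R := \big[setU/set0]_(j < M | b j == a) block M j.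
have mB : measurable B by apply: bigsetU_measurable => j _; exact: measurable_block.
have BI : B `<=` I by move=> x /bigsetU_finP[j _]; exact: block_subI.
have lebB : leb B = (#|[set j : 'I_M | b j == a]%SET|%:R / M%:R)%:E.
  rewrite (leb_sum_blocks M0 mB BI).
  rewrite (eq_bigr (fun j : 'I_M => if b j == a then (M%:R^-1)%:E else 0)).
    rewrite -big_mkcond /= sumEFin sumr_const -[(_ *+ _)%R]mulr_natl.
    by rewrite cardsE.
  move=> j _; case: ifPn => [bj|bj].
    by rewrite setIidl ?leb_block // => x xj; apply/bigsetU_finP; exists j.
  rewrite (_ : _ `&` _ = set0) ?measure0 // -subset0 => x [xj /bigsetU_finP[l bl xl]].
  by move/negP: bj; apply; rewrite (block_uniq M0 xj xl).
have : leb B <= leb (F a) + leb E.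
  apply: le_trans (measureU2 leb (mF a) mE); apply: le_measure; rewrite ?inE //.
    exact: (measurableU _ _ (mF a) mE).
  move=> x /bigsetU_finP[j /eqP bj xj]; have [Ex|nEx] := pselect (E x); first by right.
  by left; rewrite -bj; apply: colE => //; exact: (block_subI (ltn_ord j)).
rewrite lebB lebF => /le_trans /(_ (leeD2l _ lebE)); rewrite -EFinD lee_fin.
by rewrite ler_pdivrMr // mulrC.
Qed.

(** Cut each vertex interval into [M] pieces and each block into [n] pieces.
    When no colour class exceeds [(1 + delta) / #|C|] on either side, the
    deficits of the classes add up to at most [delta], and they bound the number
    of mismatches left by [exists_matching]. *)
Lemma colour_matching n M (C : finType) (c b : nat -> C) (delta : R) :
  (0 < n)%N -> (0 < M)%N -> (0 < #|C|)%N ->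
  (forall a, #|[set i : 'I_n | c i == a]%SET|%:R
               <= n%:R * ((1 + delta) / #|C|%:R))%R ->
  (forall a, #|[set j : 'I_M | b j == a]%SET|%:R
               <= M%:R * ((1 + delta) / #|C|%:R))%R ->
  exists pi : 'S_(n * M),
    (#|[set k : 'I_(n * M) | b (pi k %/ n)%N != c (k %/ M)%N]%SET|%:R
       <= delta * (n * M)%:R)%R.
Proof.
move=> n0 M0 C0 c_le b_le; set N := (n * M)%N.
have n0' : (0 < n%:R :> R)%R by rewrite ltr0n.
have M0' : (0 < M%:R :> R)%R by rewrite ltr0n.
have C0' : (0 < #|C|%:R :> R)%R by rewrite ltr0n.
pose cG (k : 'I_N) := c (k %/ M)%N.
pose cP (k : 'I_N) := b (k %/ n)%N.
have [pi miss_le] := exists_matching cP cG; exists pi.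
have classG a : (#|[set k | cG k == a]%SET|%:R
    <= N%:R * ((1 + delta) / #|C|%:R))%R.
  rewrite card_divn_class // !natrM [X in (_ <= X)%R]mulrAC.
  by rewrite ler_pM2r //; exact: c_le.
have classP a : (#|[set k | cP k == a]%SET|%:R
    <= N%:R * ((1 + delta) / #|C|%:R))%R.
  have cardP K : K = (M * n)%N -> #|[set k : 'I_K | b (k %/ n)%N == a]%SET| =
      (#|[set j : 'I_M | b j == a]%SET| * n)%N.
    by move=> ->; exact: card_divn_class.
  rewrite (cardP N) /N; last by rewrite mulnC.
  rewrite !natrM -[X in (_ <= X)%R]mulrA mulrC.
  by rewrite ler_pM2l //; exact: b_le.
apply: (@le_trans _ _ (\sum_a (N%:R * ((1 + delta) / #|C|%:R)
    - #|[set k | cP k == a]%SET|%:R))%R).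
  move: miss_le; rewrite -(ler_nat R) => /le_trans; apply.
  rewrite natr_sum; apply: ler_sum => a _.
  have [le_PG|lt_GP] := leqP #|[set k | cP k == a]%SET| #|[set k | cG k == a]%SET|.
    by rewrite natrB // lerB.
  by rewrite (eqP (ltnW lt_GP)) subr_ge0.
rewrite big_split /= sumr_const sumrN -natr_sum.
rewrite (_ : (\sum_a _)%N = N); last first.
  rewrite -[RHS]card_ord -sum1_card (partition_big cP xpredT) //=.
  by apply: eq_bigr => a _; rewrite -sum1dep_card.
by rewrite -[(_ *+ _)%R]mulr_natr -mulrA divfK ?gt_eqF //; lra.
Qed.

(** The vertices of [G] and the points of the unit interval are coloured with
    the same colours, and colours that are not in conflict determine both
    adjacency in [G] and the value of [w].  The interval exchange given by
    [colour_matching] makes the colours agree outside a set of measure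
    [2 * delta]; disagreement of the two functions then needs a bad coordinate
    or a pair of conflicting colours. *)
Lemma cut_dist_colouring (n : nat) (G : ugraph n) (w : graphon R) (C : finType)
    (c : nat -> C) (conf : rel C) (F : C -> set R) (delta : R) :
  (0 < n)%N -> (0 < delta)%R ->
  (forall a, measurable (F a)) -> (forall a, F a `<=` I) ->
  trivIset [set: C] F -> (forall a, leb (F a) = (#|C|%:R^-1)%:E) ->
  (forall (i j : 'I_n) x y, ~~ conf (c i) (c j) -> F (c i) x -> F (c j) y ->
    w x y = ((repr G : lgraph n)%qT i j)%:R%R) ->
  (forall a, #|[set i : 'I_n | c i == a]%SET|%:R
               <= n%:R * ((1 + delta) / #|C|%:R))%R ->
  cut_dist (graph_graphon R G) w <=
    (4 * delta + #|[set p : C * C | conf p.1 p.2]%SET|%:R / #|C|%:R ^+ 2)%:E.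
Proof.
move=> n0 delta0 mF FI tF lebF w_eq class_le.
have mI : measurable I by exact: measurable_itv.
pose q := #|C|.
have q0 : (0 < q)%N by apply/card_gt0P; exists (c 0%N).
have q0' : (0 < q%:R :> R)%R by rewrite ltr0n.
have q1 : (1 <= q%:R :> R)%R by rewrite ler1n.
pose eps : R := (delta / q%:R)%R.
have eps0 : (0 < eps)%R by rewrite divr_gt0.
have eps_le : (eps <= delta)%R by rewrite ler_pdivrMr // ler_peMr // ltW.
have [M [b [E [M0 [mE EI lebE] colE b_le]]]] :=
  coloured_blocks (c 0%N) eps0 mF FI tF lebF.
have [|pi card_miss] := colour_matching n0 M0 q0 class_le (b := b).
  by move=> a; rewrite mulrDl mul1r; exact: b_le.
move: pi card_miss; set N := (n * M)%N => pi.
have N0 : (0 < N)%N by rewrite muln_gt0 n0.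
have N0' : (0 < N%:R :> R)%R by rewrite ltr0n.
pose cG (k : 'I_N) := c (k %/ M)%N.
set miss := [set k | _]%SET => card_miss.
pose phi := exchange pi : R -> R.
have [homI mphi phi_leb] := lebesgue_preserving_exchange pi N0.
have mphiT : measurable_fun [set: R] phi by exact: measurable_exchange.
have mpre A : measurable A -> measurable (I `&` phi @^-1` A).
  move=> mA; apply: measurableI => //.
  by rewrite -[X in measurable X]setTI; exact: mphiT.
pose Bm : set R := \big[setU/set0]_(k in miss) block N k.
have mBm : measurable Bm by apply: bigsetU_measurable => k _; exact: measurable_block.
(* The points in mismatched pieces, those sent to the exceptional set, and [0],
   which lies in no block. *)
pose Bad := Bm `|` (I `&` phi @^-1` E) `|` [set 0%R].
have mBad : measurable Bad.
  apply: measurableU; last exact: measurable_set1.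
  by apply: measurableU => //; exact: mpre.
have lebBad : leb Bad <= (2 * delta)%:E.
  rewrite /Bad measureU0; [|by apply: measurableU => //; exact: mpre| |]; last 2 first.
  - exact: measurable_set1.
  - exact: lebesgue_measure_set1.
  apply: le_trans (measureU2 leb mBm (mpre _ mE)) _.
  have pre_E : leb (I `&` phi @^-1` E) <= delta%:E.
    by rewrite (phi_leb E mE EI) (le_trans lebE) // lee_fin.
  rewrite mulr_natl mulr2n EFinD; apply: leeD; last exact: pre_E.
  apply: le_trans (measure_bigsetU_le leb _ _) _; first by move=> k; exact: measurable_block.
  rewrite (eq_bigr (fun=> (N%:R^-1)%:E)); last by move=> k _; exact: leb_block.
  by rewrite sumEFin sumr_const -[(_ *+ _)%R]mulr_natl lee_fin ler_pdivrMr.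
have good x : I x -> ~ Bad x -> exists2 k : 'I_N, block N k x & F (cG k) (phi x).
  move=> Ix nBad; have /= := Ix; rewrite in_itv /= => /andP[x0 x1].
  have nx0 : x != 0%R by apply/eqP => x00; apply: nBad; right.
  have [|k xk] := @block_exists N x N0; first by rewrite lt_neqAle eq_sym nx0 x0.
  exists k => //; have : k \notin miss.
    by apply/negP => km; apply: nBad; left; left; apply/bigsetU_finP; exists k.
  rewrite inE negbK /cG => /eqP <-; apply: colE; first exact: homI.
    by apply: block_coarsen => //; rewrite mulnC; exact: (exchange_in_block pi N0 xk).
  by move=> Ex; apply: nBad; left; right.
pose fib a := I `&` phi @^-1` F a.
(* The two functions can differ only on [D]. *)
pose D := Bad `*` I `|` I `*` Bad `|`
  \big[setU/set0]_(p : C * C | conf p.1 p.2) (fib p.1 `*` fib p.2).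
have mX p : measurable (fib p.1 `*` fib p.2) by apply: measurableX; exact: mpre.
have mD0 : measurable (Bad `*` I `|` I `*` Bad).
  by apply: measurableU; apply: measurableX.
have mDc : measurable
    (\big[setU/set0]_(p : C * C | conf p.1 p.2) (fib p.1 `*` fib p.2)).
  by apply: bigsetU_measurable => p _; exact: mX.
have mD : measurable D by exact: measurableU.
have lebX (A B : set R) : measurable A -> measurable B ->
    leb2 (A `*` B) = leb A * leb B by move=> mA mB; rewrite product_measure1E.
have lebfib a : leb (fib a) = (q%:R^-1)%:E by rewrite /fib (phi_leb _ (mF a) (FI a)).
have lebD : leb2 D <=
    (4 * delta + #|[set p : C * C | conf p.1 p.2]%SET|%:R / q%:R ^+ 2)%:E.
  apply: le_trans (measureU2 leb2 mD0 mDc) _; rewrite EFinD leeD //.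
    apply: (@le_trans _ _ (leb2 (Bad `*` I) + leb2 (I `*` Bad))).
      by apply: (measureU2 leb2); exact: measurableX.
    rewrite !lebX // leb_unit mule1 mul1e.
    rewrite (_ : 4 * delta = 2 * delta + 2 * delta)%R; last by ring.
    by rewrite EFinD leeD.
  apply: le_trans (measure_bigsetU_le leb2 _ mX) _.
  rewrite (eq_bigr (fun=> (q%:R ^- 2)%:E)); last first.
    move=> p _; transitivity (leb2 (fib p.1 `*` fib p.2)); first by [].
    by rewrite lebX; [|exact: mpre..]; rewrite !lebfib -EFinM -expr2 exprVn.
  by rewrite sumEFin sumr_const -[(_ *+ _)%R]mulr_natl cardsE.
apply: le_trans lebD; apply: (@le_trans _ _ (cut_norm (fun z =>
    graph_graphon R G z.1 z.2 - w (phi z.1) (phi z.2))%R)).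
  by apply: ereal_inf_lbound; exists phi => //; exact: invertible_exchange.
have mII : measurable (I `*` I) by exact: measurableX.
apply: cut_norm_le_measure => //.
- apply: measurable_funB; first exact: gfun_measurable.
  apply: (measurable_comp (F := I `*` I) (f := fun z : R * R => w z.1 z.2)
    (g := fun z : R * R => (phi z.1, phi z.2))) => //.
  + by move=> _ [z [z1 z2] <-]; split; exact: homI.
  + exact: gfun_measurable.
  + apply: measurable_funTS; apply: measurable_fun_pair;
      exact: (measurableT_comp mphiT).
- move=> [x y] [/= Ix Iy].
  have := gfun_range (graph_graphon R G) Ix Iy.
  have := gfun_range w (homI _ Ix) (homI _ Iy).
  by move=> /andP[? ?] /andP[? ?]; rewrite ler_norml; apply/andP; split; lra.
move=> [x y] [/= Ix Iy] nD.
have [k xk Fk] : exists2 k : 'I_N, block N k x & F (cG k) (phi x).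
  by apply: good => // Bx; apply: nD; left; left.
have [l yl Fl] : exists2 l : 'I_N, block N l y & F (cG l) (phi y).
  by apply: good => // By; apply: nD; left; right.
have nconf : ~~ conf (cG k) (cG l).
  by apply/negP => kl; apply: nD; right; apply/bigsetU_finP; exists (cG k, cG l).
have lt_n (m : 'I_N) : (m %/ M < n)%N by rewrite ltn_divLR.
have xk' : block n (Ordinal (lt_n k)) x by apply: block_coarsen.
have yl' : block n (Ordinal (lt_n l)) y by apply: block_coarsen.
rewrite (step_fun_block _ xk' yl').
by rewrite (@w_eq (Ordinal (lt_n k)) (Ordinal (lt_n l))) ?subrr.
Qed.

(** * Balanced inversion graphs are close to the limit *)

Lemma block_lt m a b (x y : R) : (0 < m)%N -> block m a x -> block m b y ->
  a != b -> (x < y)%R = (a < b)%N.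
Proof.
move=> m0 /(blockE _ _ m0) /andP[ax xa] /(blockE _ _ m0) /andP[by_ yb] ab.
have m0' : (0 < m%:R :> R)%R by rewrite ltr0n.
rewrite -(ltr_pM2l m0'); apply/idP/idP => [xy|lt_ab].
  by have := lt_trans ax (lt_le_trans xy yb); rewrite ltr_nat ltnS leq_eqVlt (negbTE ab).
by apply: le_lt_trans xa (le_lt_trans _ by_); rewrite ler_nat.
Qed.

(** For two cells in different rows and different columns, the order of both
    coordinates is the order of the cells, for points of the square and for
    points of the permutation alike. *)
Lemma perm_fun_cells m L n (s : 'S_n) (i j : 'I_n) (Psi : R -> R * R) (x y : R) :
  (0 < m)%N -> (i %/ L != j %/ L)%N -> (s i %/ L != s j %/ L)%N ->
  block m (i %/ L) (Psi x).1 -> block m (s i %/ L) (Psi x).2 ->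
  block m (j %/ L) (Psi y).1 -> block m (s j %/ L) (Psi y).2 ->
  perm_fun Psi x y = (inv_mx s i j)%:R%R.
Proof.
move=> m0 ij sij x1 x2 y1 y2.
have div_lt (u v : nat) : (u %/ L != v %/ L -> (u %/ L < v %/ L) = (u < v))%N.
  move=> uv; have [lt_uv|le_vu] := ltnP u v.
    by rewrite ltn_neqAle uv leq_div2r // ltnW.
  by rewrite ltnNge leq_div2r.
rewrite /perm_fun inv_mxE; congr ((nat_of_bool _)%:R)%R.
have ji : (j %/ L != i %/ L)%N by rewrite eq_sym.
have sji : (s j %/ L != s i %/ L)%N by rewrite eq_sym.
have := block_lt m0 x1 y1 ij; have := block_lt m0 y1 x1 ji.
have := block_lt m0 x2 y2 sij; have := block_lt m0 y2 x2 sji.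
rewrite (div_lt _ _ ij) (div_lt _ _ ji) (div_lt _ _ sij) (div_lt _ _ sji).
move=> <- <- <- <-.
set a := (Psi x).1; set b := (Psi y).1; set c := (Psi x).2; set d := (Psi y).2.
case: (ltgtP a b) => ab; case: (ltgtP c d) => cd /=; apply/idP/idP => //; nra.
Qed.

(** Instance of [cut_dist_colouring] with the [m ^ 2] cells as colours, two
    cells being in conflict when they share a row or a column, and
    [delta := 1 / m]: the two error terms are [4 / m] and
    [2 * m ^ 3 / m ^ 4]. *)
Lemma cut_dist_balanced p n L (s : 'S_n) (Psi : R -> R * R)
    (hPsi : pushes_to_square Psi) : (0 < n)%N -> (0 < L)%N -> (n <= p.+1 * L)%N ->
  balanced p L s ->
  cut_dist (graph_graphon R (inversion_graph s)) (perm_graphon hPsi) <=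
    (6 / p.+1%:R)%:E.
Proof.
move=> n0 L0 n_le /forallP bal; set m := p.+1.
have [r rP] := inversion_graph_repr_iso s.
(* Vertices are numbered as in the representative of the unlabeled graph, and
   [r] sends positions of [s] to these vertices. *)
pose c (v : nat) : 'I_m * 'I_m :=
  if insub v is Some j then cell p L s ((r^-1)%g j) else (ord0, ord0).
have cE (j : 'I_n) : c j = cell p L s ((r^-1)%g j) by rewrite /c valK.
have lt_m (i : 'I_n) : (i %/ L < m)%N by rewrite ltn_divLR // (leq_trans (ltn_ord i)).
have mI : measurable I by exact: measurable_itv.
have m0' : (0 < m%:R :> R)%R by rewrite ltr0n.
pose F (a : 'I_m * 'I_m) := I `&` Psi @^-1` (block m a.1 `*` block m a.2).
have [_ mPsi pushPsi] := hPsi.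
have mB (a : 'I_m * 'I_m) : measurable (block m a.1 `*` block m a.2 : set (R * R)).
  by apply: measurableX; exact: measurable_block.
have cC : #|{: 'I_m * 'I_m}| = (m ^ 2)%N by rewrite card_prod card_ord -mulnn.
have := @cut_dist_colouring n (inversion_graph s) (perm_graphon hPsi) _ c
  (@same_line m) F (m%:R^-1)%R n0.
rewrite cC => /(_ _ _ _ _ _ _ _)/le_trans; apply.
- by rewrite invr_gt0.
- by move=> a; exact: mPsi.
- by move=> a; exact: subIsetl.
- move=> [a b] [a' b'] _ _ [x [[_ [/= xa xb]] [_ [/= xa' xb']]]].
  by congr pair; apply/val_inj; [exact: block_uniq xa xa'|exact: block_uniq xb xb'].
- move=> a; rewrite /F pushPsi //; last first.
    by move=> [x y] [/= /block_subI xI /block_subI yI]; split; [exact: xI|exact: yI].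
  rewrite product_measure1E; [|exact: measurable_block..].
  transitivity (leb (block m a.1) * leb (block m a.2)); first by [].
  by rewrite !leb_block // -EFinM -invfM -natrM mulnn.
- move=> i j x y; rewrite !cE /same_line negb_or /= => /andP[ij sij].
  rewrite /F /= !inordK // => -[_ [x1 x2]] [_ [y1 y2]].
  have inord_neq (u v : 'I_n) : inord (u %/ L) != inord (v %/ L) :> 'I_m ->
      (u %/ L)%N != (v %/ L)%N by apply: contra_neq => ->.
  have := perm_fun_cells (ltn0Sn p) (inord_neq _ _ ij) (inord_neq _ _ sij) x1 x2 y1 y2.
  by rewrite rP !permKV.
- move=> a; rewrite (_ : #|_| = #|[set i | cell p L s i == a]%SET|); last first.
    rewrite -[RHS](card_preimset _ (@perm_inj _ (r^-1)%g)); apply: eq_card => i.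
    by rewrite !inE cE.
  have bal_a : (#|[set i | cell p L s i == a]%SET|%:R * m%:R ^+ 3 <= n%:R * (m%:R + 1) :> R)%R.
    by rewrite -natrX natr1 -!natrM ler_nat; exact: bal.
  rewrite natrX (_ : (1 + m%:R^-1) / m%:R ^+ 2 = (m%:R + 1) / m%:R ^+ 3)%R; last first.
    by field; rewrite gt_eqF.
  by rewrite mulrA ler_pdivlMr ?exprn_gt0.
rewrite lee_fin natrX -exprM.
have -> : (6 / m%:R = 4 / m%:R + (2 * m%:R ^+ 3) / m%:R ^+ (2 * 2) :> R)%R.
  by field; rewrite gt_eqF.
rewrite lerD2l ler_pM2r ?invr_gt0 ?exprn_gt0 // -natrX -natrM ler_nat.
exact: card_same_line.
Qed.

End Analysis.

(** * Almost sure convergence *)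

Local Open Scope classical_set_scope.
Local Open Scope ereal_scope.

Lemma uniform_on_setC (R : realType) d (T : measurableType d) (P : probability T R)
    (F : finType) (A B : {set F}) (X : T -> F) : uniform_on P A X ->
  measurable (X @^-1` [set x | x \notin B]) /\
  P (X @^-1` [set x | x \notin B]) <= (#|A :\: B|%SET%:R / #|A|%:R)%:E.
Proof.
move=> unif; have mX x : measurable (X @^-1` [set x]) by have [] := unif x.
have -> : X @^-1` [set x | x \notin B] =
    \big[setU/set0]_(x | x \notin B) (X @^-1` [set x]).
  apply/seteqP; split => t /=; first by move=> tB; apply/bigsetU_finP; exists (X t).
  by move=> /bigsetU_finP[x xB /= ->].
split; first exact: bigsetU_measurable.
apply: le_trans (measure_bigsetU_le P _ mX) _.
rewrite (eq_bigr (fun x => if x \in A then (#|A|%:R^-1)%:E else 0)); last first.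
  by move=> x _; have [_] := unif x; case: ifP => _ Px; exact: Px.
rewrite -big_mkcondr /= sumEFin sumr_const -[(_ *+ _)%R]mulr_natl lee_fin.
rewrite ler_wpM2r ?invr_ge0 // ler_nat; apply: subset_leq_card.
by apply/fintype.subsetP => x; rewrite !inE.
Qed.

Lemma geometric_nneseries_lt_pinfty (R : realType) (u : (\bar R)^nat) (K r : R) :
  (0 <= K)%R -> (0 < r < 1)%R -> (forall n, 0 <= u n) ->
  (forall n, u n <= (K * r ^+ n)%:E) -> \sum_(n <oo) u n < +oo.
Proof.
move=> K0 /andP[r0 r1] u0 uK; apply: (@le_lt_trans _ _ (K / (1 - r))%:E); last exact: ltry.
apply: lime_le; first by apply: is_cvg_nneseries => n _ _; exact: u0.
apply: nearW => n; apply: (@le_trans _ _ (\sum_(0 <= i < n) (K * r ^+ i)%:E)).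
  by apply: lee_sum => i _; exact: uK.
rewrite sumEFin lee_fin -mulr_sumr ler_wpM2l // big_mkord.
rewrite -[X in (_ <= X)%R]mul1r ler_pdivlMr ?subr_gt0 //.
have := subrX1 r n; have := exprn_ge0 n (ltW r0).
rewrite (_ : \sum_(i < n) r ^+ i = \sum_(i < n) r ^+ i)%R //; lra.
Qed.

Theorem theorem2p1 (R : realType) (d : measure_display) (T : measurableType d)
    (P : probability T R) (G : forall n : nat, T -> ugraph n)
    (hG : forall n : nat, (0 < n)%N ->
       uniform_on P (permutation_graphs n) (G n))
    (Psi : R -> R * R) (hPsi : pushes_to_square Psi) :
  {ae P, forall t : T,
     cut_dist (graph_graphon R (G n t)) (perm_graphon hPsi)
       @[n --> \oo] --> 0}.
Proof.
have ev_balanced p : {ae P, forall t, exists N : nat, forall n, (N <= n)%N ->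
    (0 < n)%N /\ G n t \in balanced_graphs p n}.
  set n0 := (3 * p.+1 * (2 * p.+1 + 1))%N.
  have n0_gt0 n : (n0 <= n)%N -> (0 < n)%N by apply: leq_trans; rewrite !muln_gt0.
  (* The bound on the number of unbalanced permutations starts at [n0]. *)
  pose bad n := if (n0 <= n)%N then G n @^-1` [set x | x \notin balanced_graphs p n]
    else set0.
  have mbad n : measurable (bad n).
    rewrite /bad; case: ifP => // n_big.
    by have [] := uniform_on_setC (balanced_graphs p n) (hG _ (n0_gt0 n n_big)).
  have [K [r [K0 r01 ratio]]] := unbalanced_ratio R p.
  have bad_le n : P (bad n) <= (K * r ^+ n)%:E.
    have r0 : (0 < r)%R by case/andP: r01.
    rewrite /bad; case: ifP => n_big; last first.
      by rewrite measure0 lee_fin mulr_ge0 // exprn_ge0 // ltW.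
    have [_ /le_trans] := uniform_on_setC (balanced_graphs p n) (hG _ (n0_gt0 n n_big)).
    apply; rewrite lee_fin.
    have PG0 : (0 < #|permutation_graphs n|%:R :> R)%R.
      by rewrite ltr0n; apply/card_gt0P; exists (inversion_graph 1%g); apply: imset_f.
    rewrite ler_pdivrMr //; apply: le_trans (ratio n n_big).
    by rewrite ler_nat; exact: card_setD_balanced_graphs.
  exists (lim_sup_set bad); split.
  - apply: bigcap_measurable => // k _; exact: bigcup_measurable.
  - apply: lim_sup_set_cvg0 => //.
    by apply: (geometric_nneseries_lt_pinfty K0 r01) => n; rewrite ?measure_ge0 ?bad_le.
  - move=> t /= not_ev N _; apply: contrapT => not_bad; apply: not_ev.
    exists (maxn N n0) => n; rewrite geq_max => /andP[Nn n_big].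
    split; first exact: n0_gt0 n_big.
    apply: contrapT => t_bad; apply: not_bad; exists n => //.
    by rewrite /bad n_big /=; apply/negP.
have := ae_foralln ev_balanced; apply: filterS => t ev_t.
have ev_le p : \forall n \near \oo,
    cut_dist (graph_graphon R (G n t)) (perm_graphon hPsi) <= (6 / p.+1%:R)%:E.
  have [N NP] := ev_t p; exists N => // n /= /NP[n0 /imsetP[s]].
  rewrite inE => s_bal ->; apply: cut_dist_balanced s_bal => //.
  by rewrite mulnC ltnW // ltn_ceil.
apply/fine_cvgP; split.
  apply: filterS (ev_le 0%N) => n le_n; rewrite fin_numElt.
  by rewrite (lt_le_trans (ltNyr 0%R) (cut_dist_ge0 _ _)) (le_lt_trans le_n (ltry _)).
apply/cvgrPdist_le => e e0.
have [N _ NP] := near_infty_natSinv_lt (PosNum (divr_gt0 e0 (ltr0Sn R 5))).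
apply: filterS (ev_le N) => n le_n; rewrite sub0r normrN ger0_norm ?fine_ge0 ?cut_dist_ge0 //.
have := NP N (leqnn N); rewrite /= => /ltW; rewrite ler_pdivlMr // mulrC => le_e.
rewrite -lee_fin fineK; first by apply: le_trans le_n _; rewrite lee_fin.
rewrite fin_numElt.
by rewrite (lt_le_trans (ltNyr 0%R) (cut_dist_ge0 _ _)) (le_lt_trans le_n (ltry _)).
Qed.
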